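(* Let $\mathcal{H}=\mathcal{V}\oplus\mathcal{W}^{\perp}$. Let $(\mathbf{W},\mathbf{w})$ be a fusion frame for $\mathcal{W}$, $f\in\mathcal{H}$, $f_r\in\mathcal{V}$ and $\epsilon\ge0$. The following holds: (i) If $f_r$ is an $\epsilon$-consistent reconstruction of $f$ in $\mathcal{V}$, then $\|f_r-\pi_{\mathcal{V},\mathcal{W}^{\perp}}f\|\le\epsilon\,\|\pi_{\mathcal{V},\mathcal{W}^{\perp}}\|\,\|T_{\mathbf{W},\mathbf{w}}^{\dagger}\|\,\|f\|$. (ii) If $\|f_r-\pi_{\mathcal{V},\mathcal{W}^{\perp}}f\|\le\frac{\epsilon}{\|T_{\mathbf{W},\mathbf{w}}\|}\|f\|$, then $f_r$ is an $\epsilon$-consistent reconstruction of $f$ in $\mathcal{V}$.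
   Context: $\mathcal{H}$ is a separable Hilbert space over $\mathbb{R}$ or $\mathbb{C}$, $\mathcal{V},\mathcal{W}$ are closed subspaces of $\mathcal{H}$, $I$ is a countable index set. $\mathcal{H}=\mathcal{V}\oplus\mathcal{W}^{\perp}$ means a direct (not necessarily orthogonal) sum; $\pi_{\mathcal{V},\mathcal{W}^{\perp}}$ is the oblique projection with image $\mathcal{V}$ and kernel $\mathcal{W}^{\perp}$. $\mathbf{W}=\{W_i\}_{i\in I}$ is a family of closed subspaces of $\mathcal{W}$ and $\mathbf{w}=\{w_i\}_{i\in I}\in\ell^\infty(I)$ a family of weights, i.e. $w_i>0$ for all $i$. $\mathcal{K}_{\mathbf{W}}=\oplus_{i\in I}W_i$ is the Hilbert ($\ell^2$) direct sum. $(\mathbf{W},\mathbf{w})=\{(W_i,w_i)\}_{i\in I}$ is a fusion frame for $\mathcal{W}$ if there are $0<\alpha\le\beta<\infty$ with $\alpha\|f\|^2\le\sum_{i\in I}w_i^2\|\pi_{W_i}f\|^2\le\beta\|f\|^2$ for all $f\in\mathcal{W}$ ($\pi_{W_i}$ the orthogonal projection onto $W_i$). The synthesis operator $T_{\mathbf{W},\mathbf{w}}:\mathcal{K}_{\mathbf{W}}\to\mathcal{H}$, $(f_i)_{i}\mapsto\sum_i w_if_i$, is then bounded with image $\mathcal{W}$, and its adjoint is $T_{\mathbf{W},\mathbf{w}}^{*}f=(w_i\pi_{W_i}f)_{i}$. $T^{\dagger}$ denotes the Moore–Penrose pseudo-inverse of a bounded operator $T$ with closed range. For $f\in\mathcal{H}$,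 a vector $f_r\in\mathcal{V}$ is an $\epsilon$-consistent reconstruction of $f$ in $\mathcal{V}$ if $\|T_{\mathbf{W},\mathbf{w}}^{*}f_r-T_{\mathbf{W},\mathbf{w}}^{*}f\|\le\epsilon\|f\|$. *)

(* Defs.v *)
From HB Require Import structures.
From mathcomp Require Import all_boot all_order all_algebra sesquilinear complex.
From mathcomp Require Import all_classical all_reals all_analysis.
From mathcomp.analysis.showcase Require summability.

Set Implicit Arguments.
Unset Strict Implicit.
Unset Printing Implicit Defensive.

Import Order.TTheory GRing.Theory Num.Theory.
Import numFieldNormedType.Exports.

Local Open Scope classical_set_scope.
Local Open Scope ring_scope.

Variant scalar_kind := RealScalars | ComplexScalars.

Definition scalars (R : realType) (k : scalar_kind) : numFieldType :=
  match k with RealScalars => R | ComplexScalars => R[i] end.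

Definition scalar_conj (R : realType) (k : scalar_kind) :
    scalars R k -> scalars R k :=
  match k with RealScalars => idfun | ComplexScalars => @conjc R end.

Definition scalar_Re (R : realType) (k : scalar_kind) : scalars R k -> R :=
  match k with RealScalars => idfun | ComplexScalars => @complex.Re R end.

Definition real_scalar (R : realType) (k : scalar_kind) : R -> scalars R k :=
  match k with RealScalars => idfun | ComplexScalars => fun x => x%:C%C end.

Arguments scalar_conj {R k} _.
Arguments scalar_Re {R k} _.
Arguments real_scalar {R} k _.

Section scalar_facts.
Variables (R : realType) (k : scalar_kind).
Implicit Types z c : scalars R k.

Lemma scalar_ReD z c : scalar_Re (z + c) = scalar_Re z + scalar_Re c.
Proof. by case: k z c => //= -[a b] [a' b']. Qed.

Lemma scalar_Re_ge0 z : 0 <= z -> 0 <= scalar_Re z.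
Proof. by case: k z => //= -[a b]; rewrite lecE /= => /andP[]. Qed.

Lemma scalar_ReM_ge0 c z : 0 <= z ->
  scalar_Re (c * z) = scalar_Re c * scalar_Re z.
Proof.
case: k c z => //= -[a b] [a' b']; rewrite lecE /= => /andP[/eqP-> _].
by rewrite mulr0 subr0.
Qed.

Lemma scalar_conjM_ge0 c : 0 <= scalar_Re (c * scalar_conj c).
Proof.
case: k c => /= [a|[a b]] /=; first by rewrite -expr2 sqr_ge0.
by rewrite mulrN opprK addr_ge0// -expr2 sqr_ge0.
Qed.

End scalar_facts.

(* Adjoint, pseudo-inverse and operator norm are needed between H and the
   l^2 direct sum of subspaces of H; each is defined relative to the inner
   products of its domain and codomain. *)
Section operators.
Variables (R : realType) (k : scalar_kind).
Local Notation K := (scalars R k).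

(* The real-valued norm of an inner product; the norm `|x| of a normed module
   over R[i] has values in R[i]. *)
Definition hnorm (U : Type) (dU : U -> U -> K) (x : U) : R :=
  Num.sqrt (scalar_Re (dU x x)).

Variables (U V : lmodType K) (dU : U -> U -> K) (dV : V -> V -> K).

Definition opnorm (T : U -> V) : R :=
  sup [set hnorm dV (T x) | x in [set x | hnorm dU x <= 1]].

Definition is_adjoint (T : U -> V) (S : V -> U) : Prop :=
  forall x y, dV (T x) y = dU x (S y).

Definition adjoint (T : U -> V) : V -> U :=
  xget (fun=> 0) [set S | is_adjoint T S].

(* The Moore-Penrose inverse: a bounded linear S satisfying the four Penrose
   equations T S T = T, S T S = S, (T S)^* = T S, (S T)^* = S T. *)
Definition is_pseudo_inverse (T : U -> V) (S : V -> U) : Prop :=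
  [/\ linear S,
      exists M : R, forall y, hnorm dU (S y) <= M * hnorm dV y,
      (forall x, T (S (T x)) = T x) /\ (forall y, S (T (S y)) = S y),
      forall y y', dV (T (S y)) y' = dV y (T (S y')) &
      forall x x', dU (S (T x)) x' = dU x (S (T x'))].

Definition pseudo_inverse (T : U -> V) : V -> U :=
  xget (fun=> 0) [set S | is_pseudo_inverse T S].

End operators.

Section subspaces.
Variables (R : realType) (k : scalar_kind).
Local Notation K := (scalars R k).
Variables (H : completeNormedModType K).

Record closed_subspace := ClosedSubspace {
  subspace_set :> set H;
  subspace_closed : closed subspace_set;
  subspace0 : subspace_set 0;
  subspaceP : forall (a : K) x y,
    subspace_set x -> subspace_set y -> subspace_set (a *: x + y) }.

Definition separable_space : Prop := exists2 D : set H, countable D & dense D.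

Definition direct_sum (A B : set H) : Prop :=
  (forall x, exists a b, [/\ A a, B b & x = a + b]) /\ A `&` B = [set 0].

(* When H is the direct sum of A and B, this is the projection with image A
   and kernel B. *)
Definition oblique_proj (A B : set H) (x : H) : H :=
  xget 0 [set a | A a /\ B (x - a)].

Variable dot : {dot H for @scalar_conj R k}.

Definition orthocomp (A : set H) : set H :=
  [set x | forall a, A a -> dot x a = 0].

Definition orth_proj (A : set H) : H -> H := oblique_proj A (orthocomp A).

Lemma hnorm_sqr x : hnorm dot x ^+ 2 = scalar_Re (dot x x).
Proof.
rewrite sqr_sqrtr// scalar_Re_ge0//.
have [->|x0] := eqVneq x 0; first by rewrite linear0l.
by rewrite ltW// neq0_dnorm_gt0.
Qed.

Lemma hnorm_sqrZ a x : hnorm dot (a *: x) ^+ 2 =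
  scalar_Re (a * scalar_conj a) * hnorm dot x ^+ 2.
Proof.
rewrite !hnorm_sqr linearZl_LR linearZr_LR /= mulrA scalar_ReM_ge0//.
have [->|x0] := eqVneq x 0; first by rewrite linear0l.
by rewrite ltW// neq0_dnorm_gt0.
Qed.

Lemma hnorm_sqrD x y : hnorm dot (x + y) ^+ 2 <=
  2 * hnorm dot x ^+ 2 + 2 * hnorm dot y ^+ 2.
Proof.
have eD u v : dot (u + v) (u + v) =
    dot u u + dot v v + (dot u v + dot v u).
  have -> : dot (u + v) (u + v) = dot u (u + v) + dot v (u + v).
    exact: linearDl.
  have D z : dot z (u + v) = dot z u + dot z v by exact: linearDr.
  by rewrite !D [dot v u + _]addrC addrACA.
have eN : dot x (- y) + dot (- y) x = - (dot x y + dot y x).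
  have -> : dot x (- y) = - dot x y by exact: linearNr.
  have -> : dot (- y) x = - dot y x by exact: linearNl.
  by rewrite opprD.
have eNN : dot (- y) (- y) = dot y y.
  have -> : dot (- y) (- y) = - dot y (- y) by exact: linearNl.
  have -> : dot y (- y) = - dot y y by exact: linearNr.
  by rewrite opprK.
suff <- : hnorm dot (x + y) ^+ 2 + hnorm dot (x - y) ^+ 2 =
  2 * hnorm dot x ^+ 2 + 2 * hnorm dot y ^+ 2 by rewrite lerDl sqr_ge0.
rewrite !hnorm_sqr -!mulrDr mulr_natl mulr2n -!scalar_ReD !eD eN eNN.
by rewrite addrACA subrr addr0.
Qed.

End subspaces.

Section fusion.
Variables (R : realType) (k : scalar_kind).
Local Notation K := (scalars R k).
Variables (H : completeNormedModType K) (dot : {dot H for @scalar_conj R k}).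
Variables (I : countType) (Ws : I -> closed_subspace H).

Definition fusion_space_pred : {pred I -> H} := fun g =>
  `[< (forall i, (Ws i : set H) (g i)) /\
      (\esum_(i in setT) (hnorm dot (g i) ^+ 2)%:E < +oo)%E >].

Lemma fusion_space_submod : submod_closed fusion_space_pred.
Proof.
split=> [|a g h /asboolP[Wg sg] /asboolP[Wh sh]]; apply/asboolP; split.
- by move=> i; exact: subspace0.
- rewrite esum1 ?ltry// => i _.
  by rewrite hnorm_sqr [dot _ _]linear0l; case: (k).
- by move=> i; apply: subspaceP.
- pose c := 2 * scalar_Re (a * scalar_conj a).
  have c0 : 0 <= c by rewrite mulr_ge0// scalar_conjM_ge0.
  apply: (@le_lt_trans _ _ (\esum_(i in setT)
      (c%:E * (hnorm dot (g i) ^+ 2)%:E + 2%:E * (hnorm dot (h i) ^+ 2)%:E))%E).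
    apply: le_esum => i _ //=.
    rewrite -!EFinM -EFinD lee_fin (le_trans (hnorm_sqrD _ _ _))//.
    by rewrite hnorm_sqrZ mulrA.
  rewrite esumD; last 2 first.
  + by move=> i _; rewrite -EFinM lee_fin mulr_ge0 ?sqr_ge0.
  + by move=> i _; rewrite -EFinM lee_fin mulr_ge0 ?sqr_ge0.
  have sZ b (u : I -> \bar R) : 0 <= b -> (forall i, 0 <= u i)%E ->
      (\esum_(i in setT) u i < +oo)%E ->
      (\esum_(i in setT) (b%:E * u i)%E < +oo)%E.
    move=> b0 u0 su; apply: (@le_lt_trans _ _ (b%:E * \esum_(i in setT) u i)%E).
      apply: ge_ereal_sup => _ [X [finX _] <-].
      rewrite -ge0_mule_fsumr//; apply: lee_wpmul2l; first by rewrite lee_fin.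
      by apply: ereal_sup_ubound; exists X.
    by rewrite lte_mul_pinfty.
  by rewrite lte_add_pinfty// sZ// => i; rewrite lee_fin sqr_ge0.
Qed.

HB.instance Definition _ :=
  GRing.isSubmodClosed.Build K (I -> H) fusion_space_pred fusion_space_submod.

(* The Hilbert (l^2) direct sum of the Ws i, as families in H. *)
Record fusion_space := FusionSpace {
  fusion_val :> I -> H;
  _ : fusion_val \in fusion_space_pred }.

HB.instance Definition _ := [isSub for fusion_val].
HB.instance Definition _ := [Choice of fusion_space by <:].
HB.instance Definition _ := [SubChoice_isSubLmodule of fusion_space by <:].

(* summability.sum is the limit along the directed set of finite subsets
   of I. *)
Definition fusion_dot (g h : fusion_space) : K :=
  summability.sum (fun i => dot (g i) (h i) : K^o).

Definition synthesis (w : I -> R) (g : fusion_space) : H :=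
  summability.sum (fun i => real_scalar k (w i) *: g i).

Definition fusion_frame (W : set H) (w : I -> R) : Prop :=
  [/\ forall i, Ws i `<=` W,
      forall i, 0 < w i,
      exists M : R, forall i, w i <= M &
      exists alpha beta : R, [/\ 0 < alpha, alpha <= beta &
        forall f, W f ->
          ((alpha * hnorm dot f ^+ 2)%:E <=
             \esum_(i in setT)
               (w i ^+ 2 * hnorm dot (orth_proj dot (Ws i) f) ^+ 2)%:E <=
           (beta * hnorm dot f ^+ 2)%:E)%E]].

Definition consistent_reconstruction (V : set H) (w : I -> R) (eps : R)
    (f fr : H) : Prop :=
  let Tadj := adjoint fusion_dot dot (synthesis w) in
  V fr /\ hnorm fusion_dot (Tadj fr - Tadj f) <= eps * hnorm dot f.

End fusion.

Arguments fusion_dot {R k H} dot {I} Ws g h.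
Arguments synthesis {R k H} dot {I} Ws w g.
Arguments fusion_frame {R k H} dot {I} Ws W w.
Arguments consistent_reconstruction {R k H} dot {I} Ws V w eps f fr.

(* Main.v *)
Require Import Defs.
From HB Require Import structures.
From mathcomp Require Import all_boot all_order all_algebra sesquilinear complex.
From mathcomp Require Import all_classical all_reals all_analysis.
From mathcomp.analysis.showcase Require summability.
From mathcomp Require Import finmap ring lra.

Set Implicit Arguments.
Unset Strict Implicit.
Unset Printing Implicit Defensive.

Import Order.TTheory GRing.Theory Num.Theory.
Import numFieldNormedType.Exports.

Local Open Scope classical_set_scope.
Local Open Scope ring_scope.

(** Write P for the oblique projection on V along the orthogonal complement of
    W, T for the synthesis operator, T^* and T^+ for its adjoint and its
    pseudo-inverse, and put u = fr - P f, an element of V. As f - P f is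
    orthogonal to W, which contains the range of T,

      (T h, u) = (T h, fr - f) = (h, g)   where   g = T^* fr - T^* f,

    for every family h. This identity gives both claims.

    - Let p = T T^+ u. The operator T T^+ is the orthogonal projection on the
      range W of T, so u - p is orthogonal to W and P p = u, whence
      |u| <= |P| |p|. Moreover |p|^2 = (T T^+ p, u) = (T^+ p, g), which is at
      most |T^+| |p| |g|. The bound on |u| in terms of |g| follows.
    - Conversely |g|^2 = (T g, u) <= |T| |g| |u|, so |g| <= |T| |u|.

    The work lies in the facts that this computation uses.

    - The norm of P bounds P only because P is bounded. The sum of V and the
      complement of W need not be orthogonal and no angle between them is given;
      boundedness comes from completeness, through the uniform boundedness
      principle ([uniform_boundedness], [oblique_proj_bounded]).
    - T has an adjoint: the upper frame bound makes the synthesis series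
      converge unconditionally ([synthesis_cvg]) and makes the weighted family
      of the orthogonal projections of a vector square summable; exchanging sum
      and inner product identifies this family with the value of the adjoint
      ([synthesis_adjoint]).
    - T has a bounded pseudo-inverse: the lower frame bound says that the frame
      operator T T^* is coercive on W. A bounded coercive operator is
      onto
      ([frame_operator_surj]), and composing T^* with the inverse of T T^* on W
      and the orthogonal projection on W gives a solution of the Penrose
      equations ([pseudo_inverse_exists]).

    The real and the complex case are treated together: only the elementary
    properties of the scalars distinguish them, and the estimates are between
    real numbers. *)

(** * Scalars and real-valued norms *)

Section Scalars.
Variables (R : realType) (k : scalar_kind).
Local Notation K := (scalars R k).
Implicit Types (z c : K) (t : R).

Lemma scalar_ReN z : scalar_Re (- z) = - scalar_Re z.
Proof. by case: k z => //= -[a b]. Qed.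

Lemma scalar_ReB z c : scalar_Re (z - c) = scalar_Re z - scalar_Re c.
Proof. by rewrite scalar_ReD scalar_ReN. Qed.

Lemma scalar_Re0 : scalar_Re (0 : K) = 0.
Proof. by case: k. Qed.

Lemma scalar_Re_sum (J : Type) (s : seq J) (F : J -> K) :
  scalar_Re (\sum_(j <- s) F j) = \sum_(j <- s) scalar_Re (F j).
Proof.
by elim: s => [|j s ih]; rewrite ?big_nil ?scalar_Re0// !big_cons scalar_ReD ih.
Qed.

Lemma scalar_Re_realM t z : scalar_Re (real_scalar k t * z) = t * scalar_Re z.
Proof. by case: k z => //= -[a b] /=; rewrite mul0r subr0. Qed.

Lemma scalar_Re_real t : scalar_Re (real_scalar k t) = t.
Proof. by case: k. Qed.

Lemma scalar_Re_conj z : scalar_Re (scalar_conj z) = scalar_Re z.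
Proof. by case: k z => //= -[a b]. Qed.

Lemma scalar_conjD z c : scalar_conj (z + c) = scalar_conj z + scalar_conj c.
Proof. by case: k z c => //= z c; rewrite rmorphD. Qed.

Lemma scalar_conjN z : scalar_conj (- z) = - scalar_conj z.
Proof. by case: k z => //= z; rewrite rmorphN. Qed.

Lemma scalar_conjB z c : scalar_conj (z - c) = scalar_conj z - scalar_conj c.
Proof. by rewrite scalar_conjD scalar_conjN. Qed.

Lemma scalar_conjM z c : scalar_conj (z * c) = scalar_conj z * scalar_conj c.
Proof. by case: k z c => //= z c; rewrite rmorphM. Qed.

Lemma scalar_conj0 : scalar_conj (0 : K) = 0.
Proof. by case: k => //=; exact: (rmorph0 (@conjc R)). Qed.

Lemma scalar_conj_sum (J : Type) (s : seq J) (F : J -> K) :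
  scalar_conj (\sum_(j <- s) F j) = \sum_(j <- s) scalar_conj (F j).
Proof.
elim: s => [|j s ih]; rewrite ?big_nil ?scalar_conj0//.
by rewrite !big_cons scalar_conjD ih.
Qed.

Lemma scalar_conj_real t : scalar_conj (real_scalar k t) = real_scalar k t.
Proof. by case: k => //=; exact: conjc_real. Qed.

Lemma normr_scalar_conj z : `|scalar_conj z| = `|z|.
Proof. by case: k z => //= z; exact: normcJ. Qed.

Lemma real_scalarM t u :
  real_scalar k (t * u) = real_scalar k t * real_scalar k u.
Proof. by case: k => //=; rewrite rmorphM. Qed.

Lemma real_scalarD t u :
  real_scalar k (t + u) = real_scalar k t + real_scalar k u.
Proof. by case: k => //=; rewrite rmorphD. Qed.

Lemma real_scalar1 : real_scalar k (1 : R) = 1.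
Proof. by case: k. Qed.

Lemma ler_real_scalar t u : (real_scalar k t <= real_scalar k u) = (t <= u).
Proof. by case: k => //=; exact: lecR. Qed.

Lemma real_scalar0 : real_scalar k (0 : R) = 0.
Proof. by case: k. Qed.

Lemma ltr_real_scalar t u : (real_scalar k t < real_scalar k u) = (t < u).
Proof. by case: k => //=; exact: ltcR. Qed.

Lemma real_scalar_Re_ge0 z : 0 <= z -> real_scalar k (scalar_Re z) = z.
Proof.
by case: k z => //= -[a b]; rewrite lecE /= => /andP[/eqP-> _].
Qed.

Lemma scalar_Re_gt0 z : 0 < z -> 0 < scalar_Re z.
Proof.
by move=> z0; rewrite -ltr_real_scalar real_scalar_Re_ge0 ?ltW// real_scalar0.
Qed.

Lemma normr_real_scalar t : `|real_scalar k t| = real_scalar k `|t|.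
Proof.
case: k => //=; apply: etrans (normc_def _) _.
by rewrite /= expr0n /= addr0 sqrtr_sqr.
Qed.

Lemma ler_scalar_Re z : real_scalar k (scalar_Re z) <= `|z|.
Proof.
case: k z => //= [z|z]; first exact: ler_norm.
apply: le_trans (normc_ge_Re z).
apply: etrans (lecR _ _) _; exact: ler_norm.
Qed.

Lemma scalar_conjM_eq0 z : scalar_Re (z * scalar_conj z) = 0 -> z = 0.
Proof.
case: k z => /= [z|[a b]] /=.
  by move/eqP; rewrite mulf_eq0 orbb => /eqP.
rewrite mulrN opprK => /eqP; rewrite -!expr2 paddr_eq0 ?sqr_ge0//.
by rewrite !sqrf_eq0 => /andP[/eqP-> /eqP->].
Qed.

End Scalars.

Section RealNorm.
Variables (R : realType) (k : scalar_kind).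
Local Notation K := (scalars R k).

(** The norm takes its values in the scalar field; analysis is easier with its
    real-valued version, which determines it. *)
Definition rnorm (U : normedModType K) (x : U) : R := scalar_Re `|x|.

Variable U : normedModType K.
Implicit Types x y : U.

Lemma normrE x : `|x| = real_scalar k (rnorm x).
Proof. by rewrite real_scalar_Re_ge0. Qed.

Lemma rnorm_ge0 x : 0 <= rnorm x.
Proof. exact: scalar_Re_ge0. Qed.

Lemma rnorm_eq0 x : rnorm x = 0 -> x = 0.
Proof. by move=> x0; apply/eqP; rewrite -normr_eq0 normrE x0 real_scalar0. Qed.

Lemma rnorm0 : rnorm (0 : U) = 0.
Proof. by rewrite /rnorm normr0 scalar_Re0. Qed.

Lemma rnormN x : rnorm (- x) = rnorm x.
Proof. by rewrite /rnorm normrN. Qed.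

Lemma rnormB x y : rnorm (x - y) = rnorm (y - x).
Proof. by rewrite /rnorm distrC. Qed.

Lemma rnormD x y : rnorm (x + y) <= rnorm x + rnorm y.
Proof.
rewrite /rnorm -scalar_ReD -(ler_real_scalar k) !real_scalar_Re_ge0 ?addr_ge0//.
exact: ler_normD.
Qed.

Lemma rnorm_triangle y x z : rnorm (x - z) <= rnorm (x - y) + rnorm (y - z).
Proof. by rewrite (le_trans _ (rnormD _ _))// addrA subrK. Qed.

Lemma rnormZ (a : K) x : rnorm (a *: x) = rnorm (a : K^o) * rnorm x.
Proof. by rewrite {1}/rnorm normrZ scalar_ReM_ge0. Qed.

Lemma rnorm_real t : rnorm (real_scalar k t : K^o) = `|t|.
Proof. by rewrite /rnorm normr_real_scalar scalar_Re_real. Qed.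

Lemma ler_rnorm_sum (J : Type) (s : seq J) (F : J -> U) :
  rnorm (\sum_(j <- s) F j) <= \sum_(j <- s) rnorm (F j).
Proof.
elim: s => [|j s ih]; first by rewrite !big_nil rnorm0.
by rewrite !big_cons (le_trans (rnormD _ _))// lerD2l.
Qed.

(** Positive elements of the scalar field are real, so real tolerances are
    enough. *)
Lemma cvg_rnormP (T : Type) (F : set_system T) (FF : Filter F) (u : T -> U) l :
  u @ F --> l <->
  forall e : R, 0 < e -> \forall t \near F, rnorm (l - u t) <= e.
Proof.
rewrite cvgrPdist_le; split=> h e e0.
  have := h (real_scalar k e); rewrite -(real_scalar0 R k) ltr_real_scalar.
  by move=> /(_ e0); apply: filterS => t; rewrite normrE ler_real_scalar.
have := h _ (scalar_Re_gt0 e0); apply: filterS => t.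
by rewrite -(ler_real_scalar k) -normrE real_scalar_Re_ge0// ltW.
Qed.

Lemma closed_rnorm (A : set U) l : closed A ->
  (forall e : R, 0 < e -> exists2 a, A a & rnorm (l - a) <= e) -> A l.
Proof.
move=> cA hl; apply: cA => B /nbhs_ballP[e /= e0 Be].
have [|a Aa la] := hl (scalar_Re e / 2).
  by rewrite divr_gt0// scalar_Re_gt0.
exists a; split=> //; apply: Be; rewrite -ball_normE /ball_/=.
rewrite normrE -(real_scalar_Re_ge0 (ltW e0)) ltr_real_scalar.
by rewrite (le_lt_trans la)// ltr_pdivrMr// ltr_pMr ?ltr1n ?scalar_Re_gt0.
Qed.

End RealNorm.

Lemma cvg_rnorm_cauchy (R : realType) (k : scalar_kind)
    (U : completeNormedModType (scalars R k)) (T : Type) (F : set_system T)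
    (FF : ProperFilter F) (u : T -> U) :
  (forall e : R, 0 < e ->
     exists t, \forall s \near F, rnorm (u t - u s) <= e) ->
  cvg (u @ F).
Proof.
move=> h; apply/cauchy_cvgP/cauchy_exP => e e0.
have [|t ut] := h (scalar_Re e / 2); first by rewrite divr_gt0// scalar_Re_gt0.
exists (u t); rewrite /fmapE; apply: filterS ut => s us.
rewrite -ball_normE /ball_/= normrE -(real_scalar_Re_ge0 (ltW e0)).
rewrite ltr_real_scalar (le_lt_trans us)//.
by rewrite ltr_pdivrMr// ltr_pMr ?ltr1n ?scalar_Re_gt0.
Qed.

Lemma scalar_conjM_rnorm (R : realType) (k : scalar_kind) (z : scalars R k) :
  scalar_Re (z * scalar_conj z) = rnorm (z : (scalars R k)^o) ^+ 2.
Proof.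
case: k z => /= [z|z]; first by rewrite /rnorm /= real_normK ?num_real.
have nz : rnorm (z : (scalars R ComplexScalars)^o) =
    Num.sqrt (complex.Re z ^+ 2 + complex.Im z ^+ 2).
  exact: (congr1 (@complex.Re R) (normc_def z)).
transitivity (Num.sqrt (complex.Re z ^+ 2 + complex.Im z ^+ 2) ^+ 2); last first.
  exact: (congr1 (fun t => t ^+ 2) (esym nz)).
rewrite sqr_sqrtr ?addr_ge0 ?sqr_ge0//; case: z {nz} => a b /=.
by rewrite mulrN opprK !expr2.
Qed.

(** * Inner products and operator norms *)

Section InnerProducts.
Variables (R : realType) (k : scalar_kind).
Local Notation K := (scalars R k).

(** The facts about an inner product that do not involve a topology, bundled so
    that they apply both to the ambient space and to the direct sum of the
    subspaces, whose form is only known to be an inner product under the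
    hypothesis that relates the form and the norm of the ambient space. *)
Record inner_product (U : lmodType K) (d : U -> U -> K) : Prop := InnerProduct {
  inner_linear : forall a x y z, d (a *: x + y) z = a * d x z + d y z;
  innerC : forall x y, d x y = scalar_conj (d y x);
  inner_ge0 : forall x, 0 <= scalar_Re (d x x) }.

Section Theory.
Variables (U : lmodType K) (d : U -> U -> K) (hd : inner_product d).
Implicit Types x y z : U.

Lemma inner0l z : d 0 z = 0.
Proof.
by apply: (addIr (d 0 z)); rewrite add0r -{1}(mul1r (d 0 z)) -inner_linear//
   scaler0 addr0.
Qed.

Lemma innerDl x y z : d (x + y) z = d x z + d y z.
Proof. by rewrite -{1}(scale1r x) inner_linear// mul1r. Qed.

Lemma innerZl a x z : d (a *: x) z = a * d x z.
Proof. by rewrite -{1}(addr0 (a *: x)) inner_linear// inner0l addr0. Qed.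

Lemma innerNl x z : d (- x) z = - d x z.
Proof. by rewrite -scaleN1r innerZl mulN1r. Qed.

Lemma innerBl x y z : d (x - y) z = d x z - d y z.
Proof. by rewrite innerDl innerNl. Qed.

Lemma inner_suml (J : Type) (s : seq J) (F : J -> U) z :
  d (\sum_(j <- s) F j) z = \sum_(j <- s) d (F j) z.
Proof.
by elim: s => [|j s ih]; rewrite ?big_nil ?inner0l// !big_cons innerDl ih.
Qed.

Lemma inner0r z : d z 0 = 0.
Proof. by rewrite innerC// inner0l scalar_conj0. Qed.

Lemma innerDr x y z : d z (x + y) = d z x + d z y.
Proof. by rewrite innerC// innerDl scalar_conjD -!innerC. Qed.

Lemma innerZr a x z : d z (a *: x) = scalar_conj a * d z x.
Proof. by rewrite innerC// innerZl scalar_conjM -innerC. Qed.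

Lemma innerNr x z : d z (- x) = - d z x.
Proof. by rewrite innerC// innerNl scalar_conjN -innerC. Qed.

Lemma innerBr x y z : d z (x - y) = d z x - d z y.
Proof. by rewrite innerDr innerNr. Qed.

Lemma inner_ReC x y : scalar_Re (d x y) = scalar_Re (d y x).
Proof. by rewrite innerC// scalar_Re_conj. Qed.

Lemma hnorm_ge0 x : 0 <= hnorm d x.
Proof. exact: sqrtr_ge0. Qed.

Lemma hnormE x : hnorm d x ^+ 2 = scalar_Re (d x x).
Proof. by rewrite sqr_sqrtr// inner_ge0. Qed.

Lemma hnorm0 : hnorm d 0 = 0.
Proof. by rewrite /hnorm inner0l scalar_Re0 sqrtr0. Qed.

Lemma hnormN x : hnorm d (- x) = hnorm d x.
Proof. by rewrite /hnorm innerNl innerNr opprK. Qed.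

Lemma hnorm_realZ t x : hnorm d (real_scalar k t *: x) = `|t| * hnorm d x.
Proof.
rewrite /hnorm innerZl innerZr scalar_conj_real !scalar_Re_realM mulrA.
by rewrite -expr2 sqrtrM ?sqr_ge0// sqrtr_sqr.
Qed.

Lemma hnormB_sqr x y :
  hnorm d (x - y) ^+ 2 =
  hnorm d x ^+ 2 - 2 * scalar_Re (d x y) + hnorm d y ^+ 2.
Proof.
rewrite !hnormE innerBl !innerBr !scalar_ReB [scalar_Re (d y x)]inner_ReC.
by ring.
Qed.

Lemma hnormD_sqr x y :
  hnorm d (x + y) ^+ 2 =
  hnorm d x ^+ 2 + 2 * scalar_Re (d x y) + hnorm d y ^+ 2.
Proof.
rewrite !hnormE innerDl !innerDr !scalar_ReD [scalar_Re (d y x)]inner_ReC.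
by ring.
Qed.

(** Cauchy-Schwarz: the squared norm of x - t y is a nonnegative quadratic
    polynomial of the real number t. *)
Lemma inner_CS x y : scalar_Re (d x y) <= hnorm d x * hnorm d y.
Proof.
set b := scalar_Re (d x y).
have q t : 0 <= hnorm d x ^+ 2 - 2 * (t * b) + t ^+ 2 * hnorm d y ^+ 2.
  have := sqr_ge0 (hnorm d (x - real_scalar k t *: y)).
  rewrite hnormB_sqr hnorm_realZ exprMn real_normK ?num_real// innerZr.
  by rewrite scalar_conj_real scalar_Re_realM.
have [y0|y0] := eqVneq (hnorm d y) 0.
  rewrite y0 mulr0 leNgt; apply/negP => b0.
  (* at this point the polynomial, then of degree one, has the value -1 *)
  have := q ((hnorm d x ^+ 2 + 1) / (2 * b)).
  rewrite y0 expr0n mulr0 addr0.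
  have -> : 2 * ((hnorm d x ^+ 2 + 1) / (2 * b) * b) = hnorm d x ^+ 2 + 1.
    by field; rewrite gt_eqF.
  by lra.
have y_gt0 : 0 < hnorm d y by rewrite lt0r y0 hnorm_ge0.
rewrite leNgt; apply/negP => xyb.
have xy0 : 0 <= hnorm d x * hnorm d y by rewrite mulr_ge0 ?hnorm_ge0.
have : (hnorm d x * hnorm d y) ^+ 2 < b ^+ 2.
  by rewrite ltr_pXn2r// ?nnegrE; lra.
have := q (b / hnorm d y ^+ 2).
have -> : hnorm d x ^+ 2 - 2 * (b / hnorm d y ^+ 2 * b) +
   (b / hnorm d y ^+ 2) ^+ 2 * hnorm d y ^+ 2 =
   ((hnorm d x * hnorm d y) ^+ 2 - b ^+ 2) / hnorm d y ^+ 2 by field.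
by rewrite pmulr_lge0 ?invr_gt0 ?exprn_gt0//; lra.
Qed.

Lemma inner_CS_abs x y : `|scalar_Re (d x y)| <= hnorm d x * hnorm d y.
Proof.
rewrite ler_norml inner_CS andbT lerNl.
by rewrite -scalar_ReN -innerNl (le_trans (inner_CS _ _))// hnormN.
Qed.

Lemma hnormZ a x : hnorm d (a *: x) = rnorm (a : K^o) * hnorm d x.
Proof.
rewrite /hnorm innerZl innerZr mulrA -[X in X * d x x]real_scalar_Re_ge0.
  rewrite scalar_Re_realM scalar_conjM_rnorm sqrtrM ?sqr_ge0//.
  by rewrite sqrtr_sqr ger0_norm// rnorm_ge0.
by case: (k) a => /= a; [rewrite -expr2 sqr_ge0|exact: mulcJ_ge0].
Qed.

(** For c the value of the form at x and y, the value at x and c y is the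
    square of the modulus of c. *)
Lemma inner_CS_rnorm x y : rnorm (d x y : K^o) <= hnorm d x * hnorm d y.
Proof.
set c := d x y; have [c0|c0] := eqVneq (rnorm (c : K^o)) 0.
  by rewrite c0 mulr_ge0 ?hnorm_ge0.
have c_gt0 : 0 < rnorm (c : K^o) by rewrite lt0r c0 rnorm_ge0.
have := inner_CS x (c *: y).
rewrite innerZr -/c mulrC scalar_conjM_rnorm hnormZ.
by rewrite mulrCA expr2 ler_pM2l.
Qed.

End Theory.

Section Operators.
Variables (U V : lmodType K) (dU : U -> U -> K) (dV : V -> V -> K).
Hypotheses (hU : inner_product dU) (hV : inner_product dV).
Variable T : U -> V.
Hypothesis TZ : forall t x, T (real_scalar k t *: x) = real_scalar k t *: T x.
Variable M : R.
Hypothesis TM : forall x, hnorm dV (T x) <= M * hnorm dU x.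

Let opnorm_has_sup :
  has_sup [set hnorm dV (T x) | x in [set x | hnorm dU x <= 1]].
Proof.
split; first by exists (hnorm dV (T 0)), 0 => //=; rewrite hnorm0.
exists `|M| => _ [x /= x1 <-]; rewrite (le_trans (TM x))//.
rewrite (le_trans (ler_wpM2r (hnorm_ge0 _ _) (ler_norm M)))//.
by rewrite -[leRHS]mulr1 ler_wpM2l.
Qed.

Lemma opnorm_ge0 : 0 <= opnorm dU dV T.
Proof.
apply: (@le_trans _ _ (hnorm dV (T 0))); first exact: hnorm_ge0.
by apply: ub_le_sup; [exact: opnorm_has_sup.2|exists 0 => //=; rewrite hnorm0].
Qed.

(** The bound M matters: the supremum that defines the operator norm of an
    unbounded operator has the value 0. *)
Lemma opnorm_bound x : hnorm dV (T x) <= opnorm dU dV T * hnorm dU x.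
Proof.
have [x0|x0] := eqVneq (hnorm dU x) 0.
  by rewrite (le_trans (TM x))// x0 !mulr0.
have x_gt0 : 0 < hnorm dU x by rewrite lt0r x0 hnorm_ge0.
rewrite -ler_pdivrMr//; apply: ub_le_sup; first exact: opnorm_has_sup.2.
exists (real_scalar k (hnorm dU x)^-1 *: x) => /=.
  by rewrite hnorm_realZ// gtr0_norm ?invr_gt0// mulVf.
by rewrite TZ hnorm_realZ// gtr0_norm ?invr_gt0// mulrC.
Qed.

End Operators.

End InnerProducts.

(** * The projection theorem *)

Section Hilbert.
Variables (R : realType) (k : scalar_kind).
Local Notation K := (scalars R k).
Variables (H : completeNormedModType K) (dot : {dot H for @scalar_conj R k}).
Hypothesis dot_norm : forall x : H, dot x x = `|x| ^+ 2.
Implicit Types (x y z : H) (A B : set H).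

Lemma dot_inner_product : inner_product dot.
Proof.
split=> [a x y z|x y|x]; first exact: linearPl.
  by rewrite (hermitian_subproof x y) expr0 mul1r.
apply: scalar_Re_ge0; have [->|x0] := eqVneq x 0; first by rewrite linear0l.
by rewrite ltW// neq0_dnorm_gt0.
Qed.
Let hdot := dot_inner_product.

Lemma hnorm_rnorm x : hnorm dot x = rnorm x.
Proof.
rewrite /hnorm dot_norm expr2 scalar_ReM_ge0// -expr2 sqrtr_sqr ger0_norm//.
exact: rnorm_ge0.
Qed.

Lemma dot_cvgl (T : Type) (F : set_system T) (FF : Filter F) (u : T -> H) l y :
  u @ F --> l -> (fun t => dot (u t) y : K^o) @ F --> (dot l y : K^o).
Proof.
move=> /cvg_rnormP ul; apply/cvg_rnormP => e e0.
have y0 : 0 < rnorm y + 1 by rewrite ltr_wpDl ?rnorm_ge0.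
apply: filterS (ul (e / (rnorm y + 1)) (divr_gt0 e0 y0)) => t lt.
rewrite -innerBl// (le_trans (inner_CS_rnorm hdot _ _))// !hnorm_rnorm.
rewrite ler_pdivlMr// in lt; apply: le_trans lt.
by rewrite ler_wpM2l ?rnorm_ge0// lerDl.
Qed.

Definition is_subspace A :=
  A 0 /\ forall (a : K) x y, A x -> A y -> A (a *: x + y).

Lemma subspaceD A x y : is_subspace A -> A x -> A y -> A (x + y).
Proof. by move=> [_ hA] Ax Ay; rewrite -[x]scale1r; exact: hA. Qed.

Lemma subspaceZ A (a : K) x : is_subspace A -> A x -> A (a *: x).
Proof. by move=> [A0 hA] Ax; rewrite -[_ *: _]addr0; exact: hA. Qed.

Lemma subspaceB A x y : is_subspace A -> A x -> A y -> A (x - y).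
Proof.
by move=> hA Ax Ay; apply: subspaceD => //; rewrite -scaleN1r; exact: subspaceZ.
Qed.

Lemma closed_subspaceP (W : closed_subspace H) : is_subspace W.
Proof. by split; [exact: subspace0|exact: subspaceP]. Qed.

Lemma orthocomp_subspace A : is_subspace (orthocomp dot A).
Proof.
split=> [a _|a x y Ax Ay b Bb]; first by rewrite inner0l.
by rewrite inner_linear// Ax// Ay// mulr0 addr0.
Qed.

(** The distance from x to A is the infimum of the norms of x - a; by the
    parallelogram identity a minimizing sequence is Cauchy. *)
Lemma minimizing_limit A x : is_subspace A ->
  exists l, (forall e : R, 0 < e -> exists2 a, A a & rnorm (l - a) <= e) /\
            forall b, A b -> rnorm (x - l) <= rnorm (x - l - b).
Proof.
move=> hA; pose D := [set rnorm (x - a) | a in A].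
have hD : has_inf D.
  split; first by exists (rnorm (x - 0)), 0 => //; exact: hA.1.
  by exists 0 => _ [a _ <-]; exact: rnorm_ge0.
pose m := inf D; have m0 : 0 <= m.
  by apply: lb_le_inf; [exact: hD.1|move=> _ [a _ <-]; exact: rnorm_ge0].
have mA a : A a -> m <= rnorm (x - a).
  by move=> Aa; apply: ge_inf; [exact: hD.2|exists a].
have near_inf (n : nat) : exists a, A a /\ rnorm (x - a) < m + n.+1%:R^-1.
  have [|_ [a Aa <-] ha] := @inf_adherent _ D n.+1%:R^-1 _ hD.
    by rewrite invr_gt0.
  by exists a.
have [u hu] := choice near_inf.
have close i j (d : R) : 0 < d -> i.+1%:R^-1 <= d -> j.+1%:R^-1 <= d ->
    rnorm (u i - u j) ^+ 2 <= 4 * d * (2 * m + d).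
  move=> d0 di dj.
  have [Ai ui] := hu i; have [Aj uj] := hu j.
  pose p := x - u i; pose q := x - u j.
  have mid : 2 * m <= rnorm (p + q).
    have -> : p + q =
        real_scalar k 2 *: (x - real_scalar k 2^-1 *: (u i + u j)).
      rewrite scalerBr scalerA -real_scalarM divff ?pnatr_eq0//.
      have -> : real_scalar k 2 = 2 :> K.
        by rewrite (real_scalarD _ 1 1) real_scalar1.
      by rewrite real_scalar1 scale1r scaler_nat mulr2n /p /q addrACA opprD.
    rewrite rnormZ rnorm_real ger0_norm// ler_pM2l//.
    exact: mA (subspaceZ _ hA (subspaceD hA Ai Aj)).
  have -> : u i - u j = q - p by rewrite /p /q opprB [RHS]addrC addrA subrK.
  have := hnormD_sqr hdot q p; have := hnormB_sqr hdot q p.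
  rewrite !hnorm_rnorm [q + p]addrC => hB hP.
  have p0 := rnorm_ge0 p; have q0 := rnorm_ge0 q.
  have pm : rnorm p <= m + d by rewrite /p (le_trans (ltW ui))// lerD2l.
  have qm : rnorm q <= m + d by rewrite /q (le_trans (ltW uj))// lerD2l.
  by nra.
have cu : cvg (u @ \oo).
  apply: cvg_rnorm_cauchy => e e0.
  (* for d at most 1, the bound 4 d (2 m + d) is at most 4 d (2 m + 1) *)
  pose d := Num.min 1 (e ^+ 2 / (4 * (2 * m + 1))).
  have d0 : 0 < d by rewrite lt_min ltr01 /= divr_gt0 ?exprn_gt0//; lra.
  have [N _ hN] : \forall n \near \oo, n.+1%:R^-1 <= d.
    by near=> n; apply/ltW; near: n; exact: (near_infty_natSinv_lt (PosNum d0)).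
  exists N; exists N => //= n Nn.
  have dn := hN _ Nn; have dN := hN N (leqnn N).
  rewrite -(@ler_pXn2r _ 2)// ?nnegrE ?rnorm_ge0 ?(ltW e0)//.
  rewrite (le_trans (close _ _ _ d0 dN dn))//.
  have d1 : d <= 1 by rewrite ge_min lexx.
  have de : d * (4 * (2 * m + 1)) <= e ^+ 2.
    by rewrite -ler_pdivlMr ?ge_min ?lexx ?orbT//; lra.
  by nra.
move/cvg_ex: cu => [l /cvg_rnormP ul]; exists l; split=> [e e0|b Ab].
  have [N _ /(_ N (leqnn N)) lN] := ul e e0.
  by exists (u N) => //; exact: (hu N).1.
suff h (e : R) : 0 < e -> rnorm (x - l) <= rnorm (x - l - b) + e.
  exact/ler_addgt0Pr.
move=> e0.
have e3 : 0 < e / 3 by rewrite divr_gt0.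
near \oo => n.
have un : rnorm (l - u n) <= e / 3 by near: n; exact: ul.
have ne : n.+1%:R^-1 < e / 3.
  by near: n; exact: (near_infty_natSinv_lt (PosNum e3)).
have [An xn] := hu n.
have h1 := rnorm_triangle (u n) x l.
have h2 : m <= rnorm (x - l - b) + rnorm (l - u n).
  rewrite (le_trans (mA _ (subspaceD hA Ab An)))//.
  apply: le_trans (rnormD _ _); rewrite le_eqVlt; apply/orP; left; apply/eqP.
  by congr rnorm; rewrite opprD [x - l - b]addrAC !addrA subrK.
rewrite (rnormB (u n)) in h1.
move: (n.+1%:R^-1) xn ne => s xn ne.
by lra.
Unshelve. all: by end_near. Qed.

(** Among the multiples of b there is one whose product with z is the squared
    modulus of the product of z and b. *)
Lemma dot_eq0_Re z b :
  (forall c : K, scalar_Re (dot z (c *: b)) = 0) -> dot z b = 0.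
Proof.
move=> /(_ (dot z b)); rewrite innerZr// mulrC; exact: scalar_conjM_eq0.
Qed.

(** Projection theorem, for a subspace that need not be closed: the nearest
    point then lies in the closure. *)
Lemma projection_limit A x : is_subspace A ->
  exists l, (forall e : R, 0 < e -> exists2 a, A a & rnorm (l - a) <= e) /\
            orthocomp dot A (x - l).
Proof.
move=> hA; have [l [la lmin]] := minimizing_limit x hA.
exists l; split=> // b Ab; apply: dot_eq0_Re => c.
move: (c *: b) (subspaceZ c hA Ab) => {c Ab}b Ab.
move: (x - l) lmin => y lmin; set r := scalar_Re _.
have q (t : R) : 0 <= t ^+ 2 * rnorm b ^+ 2 - 2 * (t * r).
  have := lmin _ (subspaceZ (real_scalar k t) hA Ab).
  rewrite -(@ler_pXn2r _ 2)// ?nnegrE ?rnorm_ge0// -!hnorm_rnorm hnormB_sqr//.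
  rewrite hnorm_realZ// innerZr// scalar_conj_real scalar_Re_realM exprMn.
  rewrite real_normK ?num_real// -/r !hnorm_rnorm; lra.
apply/eqP; rewrite -[_ == 0]negbK; apply/negP => r0.
have b0 : 0 < rnorm b ^+ 2 + 1 by rewrite ltr_wpDl ?sqr_ge0.
(* the minimizer r / |b|^2 of the polynomial, with 1 added to the denominator so
   that b may be zero; the value is negative there too *)
have := q (r / (rnorm b ^+ 2 + 1)).
have -> : (r / (rnorm b ^+ 2 + 1)) ^+ 2 * rnorm b ^+ 2 -
    2 * (r / (rnorm b ^+ 2 + 1) * r) =
    - (r ^+ 2 * (rnorm b ^+ 2 + 2) / (rnorm b ^+ 2 + 1) ^+ 2).
  by field; rewrite gt_eqF.
apply/negP; rewrite -ltNge oppr_lt0 divr_gt0 ?exprn_gt0// mulr_gt0//.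
  by rewrite lt0r sqrf_eq0 r0 sqr_ge0.
by lra.
Qed.

Lemma orth_projP (W : closed_subspace H) x :
  (W : set H) (orth_proj dot W x) /\ orthocomp dot W (x - orth_proj dot W x).
Proof.
have [l [la lo]] := projection_limit x (closed_subspaceP W).
have Wl : (W : set H) l by apply: closed_rnorm => //; exact: subspace_closed.
by rewrite /orth_proj /oblique_proj; case: xgetP => [a -> //|/(_ l)]; case.
Qed.

End Hilbert.

(** * Oblique projections and uniform boundedness *)

Section UniformBoundedness.
Variables (R : realType) (k : scalar_kind).
Local Notation K := (scalars R k).
Variables (H : completeNormedModType K) (dot : {dot H for @scalar_conj R k}).
Hypothesis dot_norm : forall x : H, dot x x = `|x| ^+ 2.
Implicit Types (x y z : H) (A B : set H).

Let hdot := dot_inner_product dot.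
Let hnormr := hnorm_rnorm dot_norm.

Lemma Re_dot_le x y : `|scalar_Re (dot x y)| <= rnorm x * rnorm y.
Proof. by rewrite -!hnormr; exact: inner_CS_abs. Qed.

Lemma geometric_small (e : R) : 0 < e -> exists n, 3^-1 ^+ n <= e.
Proof.
move=> e0; exists (Num.truncn e^-1).
rewrite exprVn -[leRHS]invrK lef_pV2 ?posrE ?invr_gt0 ?exprn_gt0//.
rewrite (le_trans (ltW (truncnS_gt _)))// -natrX ler_nat.
exact: ltn_expl.
Qed.

(** Half of 3^-n is the sum of the geometric series that dominates the steps
    after the n-th one. *)
Lemma geometric_cvg (x : nat -> H) :
  (forall n, rnorm (x n.+1 - x n) <= 3^-1 ^+ n) ->
  exists l, forall n, rnorm (l - x n.+1) <= 2^-1 * 3^-1 ^+ n.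
Proof.
move=> hx.
have tail n p : rnorm (x (n + p)%N - x n) <=
    3 / 2 * (3^-1 ^+ n - 3^-1 ^+ (n + p)).
  elim: p => [|p ih]; first by rewrite addn0 !subrr rnorm0 mulr0.
  rewrite addnS (le_trans (rnorm_triangle (x (n + p)%N) _ _))//.
  rewrite (le_trans (lerD (hx _) ih))// exprS.
  by move: (3^-1 ^+ n) (3^-1 ^+ (n + p)) => s t; lra.
have tail_le n m : (n <= m)%N -> rnorm (x m - x n) <= 3 / 2 * 3^-1 ^+ n.
  move=> nm; rewrite -(subnKC nm) (le_trans (tail _ _))//.
  by rewrite ler_wpM2l// lerBlDr lerDl exprn_ge0// invr_ge0.
have : cvg (x @ \oo).
  apply: cvg_rnorm_cauchy => e e0.
  have [|n ne] := @geometric_small (e * 2 / 3); first by lra.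
  exists n; exists n => // m /= nm.
  rewrite rnormB (le_trans (tail_le _ _ nm))//.
  by move: (3^-1 ^+ n) ne => s ne; lra.
move/cvg_ex => [l /cvg_rnormP xl]; exists l => n.
suff h (e : R) : 0 < e -> rnorm (l - x n.+1) <= 2^-1 * 3^-1 ^+ n + e.
  exact/ler_addgt0Pr.
move=> e0; have [N _ hN] := xl e e0.
rewrite (le_trans (rnorm_triangle (x (maxn N n.+1)) _ _))// addrC lerD//.
  rewrite (le_trans (tail_le _ _ (leq_maxr N n.+1)))// exprS.
  by move: (3^-1 ^+ n) => s; lra.
by apply: hN; exact: leq_maxl.
Qed.

(** Uniform boundedness principle for the functionals given by the elements of
    a set B (gliding hump). If B is unbounded, pick b n in B whose norm grows
    faster than 3^n; adding plus or minus 3^-n times the direction of b n, the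
    sign being the one that does not decrease the modulus of the product with
    b n, yields a convergent sequence, and the later terms are too small to undo
    the gain. *)
Lemma uniform_boundedness B :
  (forall x, exists C : R, forall b, B b -> `|scalar_Re (dot x b)| <= C) ->
  exists M : R, forall b, B b -> rnorm b <= M.
Proof.
move=> ptw; apply: contrapT => unb.
have large (n : nat) : exists b, B b /\ 2 * n%:R * 3 ^+ n < rnorm b.
  apply: contrapT => nb; apply: unb; exists (2 * n%:R * 3 ^+ n) => b Bb.
  by rewrite leNgt; apply/negP => hb; apply: nb; exists b.
have [b hb] := choice large.
have b0 n : 0 < rnorm (b n).
  by apply: le_lt_trans (hb n).2; rewrite !mulr_ge0// exprn_ge0.
pose h n : H := real_scalar k (3^-1 ^+ n / rnorm (b n)) *: b n.
have t0 n : 0 < 3^-1 ^+ n :> R by rewrite exprn_gt0// invr_gt0.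
have hn n : rnorm (h n) = 3^-1 ^+ n.
  rewrite /h rnormZ rnorm_real ger0_norm ?divr_ge0 ?ltW//.
  by rewrite divfK// gt_eqF.
have hbn n : scalar_Re (dot (h n) (b n)) = 3^-1 ^+ n * rnorm (b n).
  rewrite innerZl// scalar_Re_realM -hnormE// hnormr.
  by field; rewrite gt_eqF.
pose fix x n : H := if n is m.+1 then
  (if 0 <= scalar_Re (dot (x m) (b m)) then x m + h m else x m - h m) else 0.
have gain n : 3^-1 ^+ n * rnorm (b n) <= `|scalar_Re (dot (x n.+1) (b n))|.
  have g0 : 0 <= 3^-1 ^+ n * rnorm (b n) by rewrite mulr_ge0 ?ltW.
  rewrite /=; case: ifPn => [p|]; last rewrite -ltNge => p.
    by rewrite innerDl// scalar_ReD hbn ger0_norm ?addr_ge0// lerDr.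
  rewrite innerBl// scalar_ReB hbn ltr0_norm; last first.
    by rewrite subr_lt0 (lt_le_trans p).
  by rewrite opprB lerBrDl gerDr ltW.
have [n|l xl] := @geometric_cvg x.
  rewrite /=; case: ifP => _; first by rewrite addrC addKr hn.
  by rewrite addrC addKr rnormN hn.
have [C hC] := ptw l.
pose n := (Num.truncn C).+1.
have Cn : C < n%:R by exact: truncnS_gt.
have := hC _ (hb n).1; apply/negP; rewrite -ltNge (lt_le_trans Cn)//.
have split_x : dot (x n.+1) (b n) = dot l (b n) - dot (l - x n.+1) (b n).
  by rewrite innerBl// opprB addrC subrK.
have := gain n; rewrite split_x scalar_ReB => /le_trans/(_ (ler_normB _ _)).
have := Re_dot_le (l - x n.+1) (b n).
have := ler_wpM2r (ltW (b0 n)) (xl n).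
have : n%:R * 2 <= 3^-1 ^+ n * rnorm (b n).
  rewrite exprVn [leRHS]mulrC ler_pdivlMr ?exprn_gt0// [n%:R * 2]mulrC.
  exact: ltW (hb n).2.
move: (3^-1 ^+ n) (rnorm (b n)) (rnorm (l - _)) => s t u.
by lra.
Qed.

Lemma oblique_projP A B x : direct_sum A B ->
  A (oblique_proj A B x) /\ B (x - oblique_proj A B x).
Proof.
move=> [/(_ x)[a [b [Aa Bb xab]]] _]; rewrite /oblique_proj.
case: xgetP => [c -> //|/(_ a)]; case; split=> //.
by rewrite xab addrC addKr.
Qed.

Lemma oblique_proj_unique A B x a : is_subspace A -> is_subspace B ->
  direct_sum A B -> A a -> B (x - a) -> oblique_proj A B x = a.
Proof.
move=> hA hB AB Aa Bxa; have [Ap Bp] := oblique_projP x AB.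
have : (A `&` B) (oblique_proj A B x - a).
  split; first exact: subspaceB.
  have -> : oblique_proj A B x - a = (x - a) - (x - oblique_proj A B x).
    by rewrite opprB [RHS]addrC addrA subrK.
  exact: subspaceB.
by rewrite AB.2 => /eqP; rewrite subr_eq0 => /eqP.
Qed.

Lemma oblique_proj_linear A B (a : K) x y : is_subspace A -> is_subspace B ->
  direct_sum A B ->
  oblique_proj A B (a *: x + y) = a *: oblique_proj A B x + oblique_proj A B y.
Proof.
move=> hA hB AB; have [Ax Bx] := oblique_projP x AB.
have [Ay By] := oblique_projP y AB.
apply: oblique_proj_unique => //; first exact: hA.2.
by rewrite opprD addrACA -scalerBr; exact: hB.2.
Qed.

Lemma direct_sum_orthocomp (W : closed_subspace H) :
  direct_sum W (orthocomp dot W).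
Proof.
split=> [x|].
  have [Wp Op] := orth_projP dot_norm W x.
  exists (orth_proj dot W x), (x - orth_proj dot W x).
  by split=> //; rewrite [RHS]addrC subrK.
apply/seteqP; split=> [x [Wx Ox]|_ ->].
  by apply: rnorm_eq0; rewrite -hnormr /hnorm Ox// scalar_Re0 sqrtr0.
by split; [exact: subspace0|exact: (orthocomp_subspace dot W).1].
Qed.

Lemma orth_proj_linear (W : closed_subspace H) (a : K) x y :
  orth_proj dot W (a *: x + y) = a *: orth_proj dot W x + orth_proj dot W y.
Proof.
apply: oblique_proj_linear; [exact: closed_subspaceP|exact: orthocomp_subspace|].
exact: direct_sum_orthocomp.
Qed.

Lemma orth_proj0 (W : closed_subspace H) : orth_proj dot W 0 = 0.
Proof.
by have := orth_proj_linear W (-1) 0 0; rewrite !scaleN1r !addNr.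
Qed.

Lemma orth_projZ (W : closed_subspace H) (a : K) x :
  orth_proj dot W (a *: x) = a *: orth_proj dot W x.
Proof. by rewrite -[a *: x]addr0 orth_proj_linear orth_proj0 addr0. Qed.

Lemma orth_proj_id (W : closed_subspace H) x :
  (W : set H) x -> orth_proj dot W x = x.
Proof.
move=> Wx; apply: oblique_proj_unique => //.
- exact: closed_subspaceP.
- exact: orthocomp_subspace.
- exact: direct_sum_orthocomp.
- by rewrite subrr; exact: (orthocomp_subspace dot W).1.
Qed.

Lemma orthocomp_sym A x y : orthocomp dot A x -> A y -> dot y x = 0.
Proof. by move=> Ax Ay; rewrite innerC// Ax// scalar_conj0. Qed.

Lemma dot_orth_proj (W : closed_subspace H) x y :
  (W : set H) y -> dot y (orth_proj dot W x) = dot y x.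
Proof.
move=> Wy; have [_ Ox] := orth_projP dot_norm W x.
by apply/eqP; rewrite eq_sym -subr_eq0 -innerBr// (orthocomp_sym Ox).
Qed.

Lemma orth_proj_sym (W : closed_subspace H) x y :
  dot (orth_proj dot W x) y = dot x (orth_proj dot W y).
Proof.
have [Wx _] := orth_projP dot_norm W x.
have [Wy _] := orth_projP dot_norm W y.
by rewrite -(dot_orth_proj y Wx) innerC// (dot_orth_proj x Wy) -innerC.
Qed.

(** Duality: for w in W one has (P x, w) = (x, w), so the elements w of W whose
    orthogonal projection on V has norm at most 1 are pointwise bounded by the
    norm of P x, hence bounded; and these projections are dense in V because
    what is orthogonal to all of them in V is orthogonal to W. *)
Lemma oblique_proj_bounded (V W : closed_subspace H) :
  direct_sum V (orthocomp dot W) ->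
  exists M : R, forall x,
    rnorm (oblique_proj V (orthocomp dot W) x) <= M * rnorm x.
Proof.
move=> VW; set P := oblique_proj V (orthocomp dot W).
pose Q := orth_proj dot V.
have PQ x w : (W : set H) w -> dot (P x) (Q w) = dot x w.
  move=> Ww; have [VP WP] := oblique_projP x VW.
  by rewrite dot_orth_proj//; apply/eqP; rewrite eq_sym -subr_eq0 -innerBl// WP.
have Q0 w : (W : set H) w -> rnorm (Q w) = 0 -> w = 0.
  move=> Ww /rnorm_eq0 Qw; apply: rnorm_eq0; rewrite -hnormr /hnorm.
  by rewrite -PQ// Qw inner0r// scalar_Re0 sqrtr0.
have [M hM] : exists M : R, forall b,
    [set w | (W : set H) w /\ rnorm (Q w) <= 1] b -> rnorm b <= M.
  apply: uniform_boundedness => x; exists (rnorm (P x)) => w [Ww Qw1].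
  rewrite -PQ// (le_trans (Re_dot_le _ _))//.
  by rewrite -[leRHS]mulr1 ler_wpM2l ?rnorm_ge0.
have M0 : 0 <= M.
  apply: le_trans (rnorm_ge0 (0 : H)) (hM 0 _); split; first exact: subspace0.
  by rewrite /Q orth_proj0 rnorm0.
have QM w : (W : set H) w -> rnorm w <= M * rnorm (Q w).
  move=> Ww; have [Qw|Qw] := eqVneq (rnorm (Q w)) 0.
    by rewrite Qw mulr0 (Q0 _ Ww Qw) rnorm0.
  have Qw0 : 0 < rnorm (Q w) by rewrite lt0r Qw rnorm_ge0.
  have := hM (real_scalar k (rnorm (Q w))^-1 *: w).
  rewrite rnormZ rnorm_real gtr0_norm ?invr_gt0//.
  rewrite mulrC ler_pdivrMr//; apply; split.
    by apply: subspaceZ => //; exact: closed_subspaceP.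
  by rewrite /Q orth_projZ rnormZ rnorm_real gtr0_norm ?invr_gt0// mulVf.
exists M => x; have [VP WP] := oblique_projP x VW; rewrite -/P in VP WP.
have sQW : is_subspace [set Q w | w in (W : set H)].
  split; first by exists 0; [exact: subspace0|exact: orth_proj0].
  move=> a _ _ [u Wu <-] [v Wv <-]; exists (a *: u + v); first exact: subspaceP.
  exact: orth_proj_linear.
have [l [ql ol]] := projection_limit dot_norm (P x) sQW.
have Vl : (V : set H) l.
  apply: closed_rnorm => [|e /ql[_ [w Ww <-] lw]]; first exact: subspace_closed.
  by exists (Q w) => //; exact: (orth_projP dot_norm V w).1.
have Pl : P x = l.
  have Vd : (V : set H) (P x - l).
    by apply: subspaceB => //; exact: closed_subspaceP.
  have : ((V : set H) `&` orthocomp dot W) (P x - l).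
    split=> // w Ww; rewrite -(dot_orth_proj w Vd); apply: ol.
    by exists w.
  by rewrite VW.2 => /eqP; rewrite subr_eq0 => /eqP.
have [->|Px0] := eqVneq (rnorm (P x)) 0; first by rewrite mulr_ge0 ?rnorm_ge0.
have Px_gt0 : 0 < rnorm (P x) by rewrite lt0r Px0 rnorm_ge0.
rewrite -(ler_pM2l Px_gt0) -expr2 -{1}hnormr hnormE//.
(* If Q w is close to P x with w in W, then (P x, P x) is close to
   (P x, Q w) = (x, w), and the norm of w is at most M times that of Q w. *)
set D := rnorm (P x) + M * rnorm x.
suff h (e : R) : 0 < e ->
    scalar_Re (dot (P x) (P x)) <= rnorm (P x) * (M * rnorm x) + e * D.
  have D0 : 0 < D by rewrite ltr_pwDl ?mulr_ge0 ?rnorm_ge0.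
  suff h' (e : R) : 0 < e ->
      scalar_Re (dot (P x) (P x)) <= rnorm (P x) * (M * rnorm x) + e.
    exact/ler_addgt0Pr.
  by move=> e0; have := h (e / D) (divr_gt0 e0 D0); rewrite divfK// gt_eqF.
move=> e0; have [_ [w Ww <-]] := ql e e0; rewrite -Pl => we.
have -> : dot (P x) (P x) = dot (P x) (P x - Q w) + dot x w.
  by rewrite innerBr// PQ// subrK.
rewrite scalar_ReD.
have h1 := le_trans (ler_norm _) (Re_dot_le (P x) (P x - Q w)).
have h2 := le_trans (ler_norm _) (Re_dot_le x w).
have h3 := QM w Ww.
have h4 : rnorm (Q w) <= rnorm (P x) + e.
  have := rnorm_triangle (P x) (Q w) 0; rewrite !subr0 rnormB; lra.
have h5 : rnorm (P x) * rnorm (P x - Q w) <= rnorm (P x) * e.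
  by rewrite ler_wpM2l ?rnorm_ge0.
have h6 : rnorm x * rnorm w <= rnorm x * (M * (rnorm (P x) + e)).
  by rewrite ler_wpM2l ?rnorm_ge0// (le_trans h3)// ler_wpM2l.
rewrite /D; nra.
Qed.

End UniformBoundedness.

(** * Unconditional sums and the direct sum of the subspaces *)

#[local] Existing Instance summability.totally_filter.

Section Sums.
Variables (R : realType) (I : choiceType).

Lemma partial_sumE (U : zmodType) (x : I -> U) (F : {fset I}) :
  summability.partial_sum x F = \sum_(i <- F) x i.
Proof. by rewrite /summability.partial_sum big_seq_fsetE. Qed.

Lemma near_totally (F : {fset I}) (P : {fset I} -> Prop) :
  (forall G : {fset I}, (F `<=` G)%fset -> P G) ->
  \forall G \near summability.totally, P G.
Proof. by move=> h; exists F. Qed.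

Lemma sum_fsetD (U : zmodType) (x : I -> U) (F G : {fset I}) :
  (F `<=` G)%fset ->
  \sum_(i <- G) x i = \sum_(i <- F) x i + \sum_(i <- (G `\` F)%fset) x i.
Proof.
move=> FG; rewrite (big_fsetID _ (mem F) G) /=; congr (_ + _).
  by apply: eq_fbigl => i; rewrite !inE /= andb_idl// => /(fsubsetP FG).
by apply: eq_fbigl => i; rewrite !inE /= andbC.
Qed.

Implicit Types a : I -> R.

Lemma ler_sum_fset a (F G : {fset I}) : (forall i, 0 <= a i) ->
  (F `<=` G)%fset -> \sum_(i <- F) a i <= \sum_(i <- G) a i.
Proof. by move=> a0 /sum_fsetD->; rewrite lerDl sumr_ge0. Qed.

Lemma esum_leP a (C : R) : (forall i, 0 <= a i) ->
  (\esum_(i in setT) (a i)%:E <= C%:E)%E <->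
  forall F : {fset I}, \sum_(i <- F) a i <= C.
Proof.
move=> a0; split=> [aC F|aC].
  rewrite -lee_fin -sumEFin (le_trans _ aC)//; apply: esum_ge.
  exists [set` F]; first by split=> //; exact: finite_fset.
  by rewrite -fsbig_seq.
apply: ge_ereal_sup => _ [X [finX _] <-].
by rewrite fsbig_finite// sumEFin lee_fin.
Qed.

Lemma esum_ltyP a : (forall i, 0 <= a i) ->
  (\esum_(i in setT) (a i)%:E < +oo)%E <->
  exists C, forall F : {fset I}, \sum_(i <- F) a i <= C.
Proof.
move=> a0; split=> [aoo|[C aC]]; last first.
  by apply: (@le_lt_trans _ _ C%:E); [exact/esum_leP|exact: ltry].
have s0 : (0 <= \esum_(i in setT) (a i)%:E)%E.
  by apply: esum_ge0 => i _; rewrite lee_fin.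
exists (fine (\esum_(i in setT) (a i)%:E)); apply/esum_leP => //.
by rewrite fineK// ge0_fin_numE.
Qed.

Variables (k : scalar_kind) (U : completeNormedModType (scalars R k)).

(** Cauchy criterion: the finite sums of a beyond a large enough finite set are
    small, and they control those of x. *)
Lemma cvg_partial_sum (x : I -> U) a : (forall i, 0 <= a i) ->
  (exists C, forall F : {fset I}, \sum_(i <- F) a i <= C) ->
  (forall e : R, 0 < e -> exists2 d : R, 0 < d & forall F : {fset I},
     \sum_(i <- F) a i <= d -> rnorm (\sum_(i <- F) x i) <= e) ->
  cvg (summability.partial_sum x @ summability.totally).
Proof.
move=> a0 [C aC] xa; apply: cvg_rnorm_cauchy => e /xa[d d0 hd].
pose D := [set \sum_(i <- F) a i | F in [set: {fset I}]].
have hD : has_sup D.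
  split; first by exists (\sum_(i <- fset0) a i), fset0.
  by exists C => _ [F _ <-].
have [_ [F _ <-] hF] := sup_adherent d0 hD.
exists F; apply: (@near_totally F) => G FG.
rewrite !partial_sumE rnormB (sum_fsetD _ FG) addrC addKr; apply: hd.
have : \sum_(i <- G) a i <= sup D by apply: ub_le_sup; [exact: hD.2|exists G].
by rewrite (sum_fsetD _ FG); lra.
Qed.

End Sums.

Section DirectSum.
Variables (R : realType) (k : scalar_kind).
Local Notation K := (scalars R k).
Variables (H : completeNormedModType K) (dot : {dot H for @scalar_conj R k}).
Hypothesis dot_norm : forall x : H, dot x x = `|x| ^+ 2.
Variables (I : countType) (Ws : I -> closed_subspace H).
Local Notation FS := (fusion_space dot Ws).
Local Notation fdot := (fusion_dot dot Ws).
Implicit Types g h : FS.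

Let hdot := dot_inner_product dot.
Let hnormr := hnorm_rnorm dot_norm.

Lemma fusion_spaceP (x : I -> H) : x \in fusion_space_pred dot Ws <->
  (forall i, (Ws i : set H) (x i)) /\
  exists C, forall F : {fset I}, \sum_(i <- F) rnorm (x i) ^+ 2 <= C.
Proof.
rewrite -esum_ltyP => [|i]; last exact: sqr_ge0.
under eq_esum do rewrite -hnormr.
by split=> [/asboolP|?] //; exact/asboolP.
Qed.

Lemma cvg_Re_le (z : I -> K) (s : K) (C : R) :
  summability.partial_sum (z : I -> K^o) @ summability.totally
    --> (s : K^o) ->
  (\forall F \near @summability.totally I,
     scalar_Re (\sum_(i <- enum_fset F) z i) <= C) ->
  scalar_Re s <= C.
Proof.
move=> /cvg_rnormP zs hC.
suff h (e : R) : 0 < e -> scalar_Re s <= C + e by exact/ler_addgt0Pr.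
move=> e0; near (@summability.totally I) => F.
have h1 : rnorm (s - summability.partial_sum (z : I -> K^o) F : K^o) <= e.
  by near: F; exact: zs.
have h2 : scalar_Re (\sum_(i <- F) z i) <= C by near: F.
rewrite partial_sumE in h1.
have : scalar_Re (s - \sum_(i <- F) z i) <= e.
  rewrite -(ler_real_scalar k); apply: le_trans (ler_scalar_Re _) _.
  by rewrite (@normrE _ _ K^o) ler_real_scalar.
by rewrite scalar_ReB; lra.
Unshelve. all: by end_near. Qed.

Lemma partial_sumN (z : I -> K) (s : K) :
  summability.partial_sum (z : I -> K^o) @ summability.totally --> (s : K^o) ->
  summability.partial_sum ((fun i => - z i) : I -> K^o) @ summability.totally
    --> (- s : K^o).
Proof.
move=> zs; rewrite (_ : summability.partial_sum _ =
  - summability.partial_sum (z : I -> K^o)); first exact: cvgN.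
by apply/funext => F; rewrite fctE !partial_sumE sumrN.
Qed.

(** The scalar field inherits completeness from a line of H. *)
Lemma cvg_scalar_line (z : I -> K) (e : H) : e != 0 ->
  cvg (summability.partial_sum (fun i => z i *: e) @ summability.totally) ->
  cvg (summability.partial_sum (z : I -> K^o) @ summability.totally).
Proof.
move=> e0 /cvg_ex[l zl].
have ee0 : dot e e != 0 by rewrite gt_eqF// neq0_dnorm_gt0.
have -> : summability.partial_sum (z : I -> K^o) = fun F =>
    dot (summability.partial_sum (fun i => z i *: e) F) e * (dot e e)^-1.
  apply/funext => F; rewrite !partial_sumE inner_suml// mulr_suml.
  by apply: eq_bigr => i _; rewrite innerZl// mulfK.
by apply/cvg_ex; exists (dot l e / dot e e); apply: cvgMr_tmp; exact: dot_cvgl.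
Qed.

(** The product of the i-th components is at most the mean of their squared
    norms, so the series is dominated by a convergent one. *)
Lemma fusion_dot_cvg g h :
  summability.partial_sum (fun i => dot (g i) (h i) : K^o) @ summability.totally
  --> (fdot g h : K^o).
Proof.
suff : cvg (summability.partial_sum (fun i => dot (g i) (h i) : K^o) @
            summability.totally) by [].
have [[e e0]|H0] := pselect (exists e : H, e != 0); last first.
  apply/cvg_ex; exists 0; apply/cvg_rnormP => e e0; near=> F.
  rewrite partial_sumE big1 ?subr0 ?rnorm0 ?ltW// => i _.
  have -> : g i = 0.
    by apply/eqP; apply: contrapT => gi; apply: H0; exists (g i); apply/negP.
  exact: inner0l.
apply: (cvg_scalar_line e0).
have [_ [C hC]] := (fusion_spaceP _).1 (valP g).
have [_ [D hD]] := (fusion_spaceP _).1 (valP h).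
have n0 : 0 < rnorm e.
  by rewrite lt0r rnorm_ge0 andbT; apply: contra_neq e0 => /rnorm_eq0.
apply: (@cvg_partial_sum R I k H _
   (fun i => (rnorm (g i) ^+ 2 + rnorm (h i) ^+ 2) / 2)) => [i||d d0].
- by rewrite divr_ge0// addr_ge0// sqr_ge0.
- exists ((C + D) / 2) => F; rewrite -mulr_suml big_split /=.
  by rewrite ler_wpM2r// lerD.
- exists (d / rnorm e); first exact: divr_gt0.
  move=> F hF; rewrite -scaler_suml rnormZ -ler_pdivlMr//.
  rewrite (le_trans (ler_rnorm_sum _ _))//; apply: le_trans hF.
  apply: ler_sum => i _; rewrite (le_trans (inner_CS_rnorm hdot _ _))//.
  rewrite !hnormr; have := sqr_ge0 (rnorm (g i) - rnorm (h i)); lra.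
Unshelve. all: by end_near. Qed.

Lemma fusion_dot_eq g h (s : K) :
  summability.partial_sum (fun i => dot (g i) (h i) : K^o) @ summability.totally
  --> (s : K^o) -> fdot g h = s.
Proof.
move=> ghs.
exact: (cvg_unique (@norm_hausdorff _ K^o) (@fusion_dot_cvg g h) ghs).
Qed.

Lemma fusion_dot_inner_product : inner_product fdot.
Proof.
split=> [a x y z|x y|x].
- apply: fusion_dot_eq.
  pose S (u : FS) : {fset I} -> K^o :=
    summability.partial_sum (fun i => dot (u i) (z i) : K^o).
  rewrite (_ : summability.partial_sum _ = (fun F => a * S x F : K^o) + S y).
    apply: cvgD (@fusion_dot_cvg y z).
    exact: cvgMl_tmp (@fusion_dot_cvg x z).
  apply/funext => F; rewrite /S fctE !partial_sumE mulr_sumr -big_split /=.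
  by apply: eq_bigr => i _; rewrite -inner_linear.
- apply: fusion_dot_eq; have /cvg_rnormP yx := @fusion_dot_cvg y x.
  apply/cvg_rnormP => e /yx; apply: filterS => F; rewrite !partial_sumE => h.
  rewrite (eq_bigr (fun i => scalar_conj (dot (y i) (x i)))); last first.
    by move=> i _; rewrite innerC.
  by rewrite -scalar_conj_sum -scalar_conjB /rnorm normr_scalar_conj.
- rewrite -oppr_le0 -scalar_ReN.
  apply: cvg_Re_le (partial_sumN (@fusion_dot_cvg x x)) _.
  near=> F; rewrite scalar_Re_sum; apply: sumr_le0 => i _.
  by rewrite scalar_ReN oppr_le0 inner_ge0.
Unshelve. all: by end_near. Qed.

Lemma fusion_norm_le g (C : R) :
  (forall F : {fset I}, \sum_(i <- F) rnorm (g i) ^+ 2 <= C) ->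
  hnorm fdot g ^+ 2 <= C.
Proof.
move=> gC; rewrite (hnormE fusion_dot_inner_product).
apply: cvg_Re_le (@fusion_dot_cvg g g) _; near=> F.
rewrite scalar_Re_sum; apply: le_trans (gC F).
by apply: ler_sum => i _; rewrite -hnormE// hnormr.
Unshelve. all: by end_near. Qed.

Lemma fusion_norm_ge g (F : {fset I}) :
  \sum_(i <- F) rnorm (g i) ^+ 2 <= hnorm fdot g ^+ 2.
Proof.
rewrite (hnormE fusion_dot_inner_product) -lerN2 -scalar_ReN.
apply: cvg_Re_le (partial_sumN (@fusion_dot_cvg g g)) _.
apply: (@near_totally _ F) => G FG; rewrite sumrN scalar_ReN lerN2.
rewrite scalar_Re_sum (le_trans (ler_sum_fset _ FG))// => [i|].
  exact: sqr_ge0.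
by apply: ler_sum => i _; rewrite -hnormE// hnormr.
Unshelve. all: by end_near. Qed.

End DirectSum.

(** * The pseudo-inverse of an operator with coercive frame operator *)

Section Coercive.
Variables (R : realType) (k : scalar_kind).
Local Notation K := (scalars R k).
Variables (H : completeNormedModType K) (dot : {dot H for @scalar_conj R k}).
Hypothesis dot_norm : forall x : H, dot x x = `|x| ^+ 2.
Variables (U : lmodType K) (dU : U -> U -> K) (hU : inner_product dU).
Variables (W : closed_subspace H) (T : U -> H) (S : H -> U).
Hypothesis adjTS : is_adjoint dU dot T S.
Hypothesis linS : linear S.
Hypothesis TW : forall g, (W : set H) (T g).
Variables (alpha beta : R).
Hypotheses (alpha0 : 0 < alpha) (beta0 : 0 <= beta).
Hypothesis S_lower : forall x, (W : set H) x ->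
  alpha * rnorm x ^+ 2 <= hnorm dU (S x) ^+ 2.
Hypothesis S_upper : forall x, hnorm dU (S x) <= beta * rnorm x.

Let hdot := dot_inner_product dot.
Let hnormr := hnorm_rnorm dot_norm.
Let hW := closed_subspaceP W.

Lemma dot_eqP x y : (forall z, dot x z = dot y z) -> x = y.
Proof.
move=> xy; apply/eqP; rewrite -subr_eq0; apply/eqP/rnorm_eq0.
by rewrite -hnormr /hnorm innerBl// xy subrr scalar_Re0 sqrtr0.
Qed.

Lemma adjoint_linear : linear T.
Proof.
by move=> a g h; apply: dot_eqP => y; rewrite adjTS !inner_linear// !adjTS.
Qed.

(** An operator with a bounded adjoint is bounded, by the same constant: bound
    the squared norm of T g, which is the product of g and S (T g). *)
Lemma adjoint_bounded g : rnorm (T g) <= beta * hnorm dU g.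
Proof.
have [->|Tg0] := eqVneq (rnorm (T g)) 0; first by rewrite mulr_ge0 ?hnorm_ge0.
have Tg_gt0 : 0 < rnorm (T g) by rewrite lt0r Tg0 rnorm_ge0.
rewrite -(ler_pM2r Tg_gt0) -expr2 -{1}hnormr hnormE// adjTS.
rewrite (le_trans (inner_CS hU _ _))// mulrAC [leRHS]mulrC.
by rewrite ler_wpM2l ?hnorm_ge0.
Qed.

Let A x := T (S x).

Let A_linear : linear A.
Proof. by move=> a x y; rewrite /A linS adjoint_linear. Qed.

Let A_sub x y : A (x - y) = A x - A y.
Proof. by rewrite addrC -scaleN1r A_linear scaleN1r addrC. Qed.

Let A_bounded x : rnorm (A x) <= beta ^+ 2 * rnorm x.
Proof.
rewrite (le_trans (adjoint_bounded _))// expr2 -mulrA ler_wpM2l//.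
Qed.

Let A_coercive x : (W : set H) x ->
  alpha * rnorm x ^+ 2 <= scalar_Re (dot (A x) x).
Proof. by move=> Wx; rewrite adjTS -hnormE//; exact: S_lower. Qed.

Let A_lower x : (W : set H) x -> alpha * rnorm x <= rnorm (A x).
Proof.
move=> Wx; have [->|x0] := eqVneq (rnorm x) 0; first by rewrite mulr0 rnorm_ge0.
have x_gt0 : 0 < rnorm x by rewrite lt0r x0 rnorm_ge0.
rewrite -(ler_pM2r x_gt0) -mulrA -expr2 (le_trans (A_coercive Wx))//.
by rewrite -!hnormr; exact: inner_CS.
Qed.

Let A_inj x y : (W : set H) x -> (W : set H) y -> A x = A y -> x = y.
Proof.
move=> Wx Wy Axy; apply/eqP; rewrite -subr_eq0; apply/eqP/rnorm_eq0.
have := A_lower (subspaceB hW Wx Wy); rewrite A_sub Axy subrr rnorm0.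
by rewrite pmulr_rle0// => h; apply/eqP; rewrite eq_le h rnorm_ge0.
Qed.

(** The range of the restriction to W of T S is dense in W, because by
    coercivity an element of W that is orthogonal to the range is zero; it is
    closed because this restriction is bounded below. *)
Lemma frame_operator_surj y : (W : set H) y ->
  exists2 x, (W : set H) x & A x = y.
Proof.
move=> Wy; have sAW : is_subspace [set A x | x in (W : set H)].
  split.
    exists 0; first exact: subspace0.
    by have := A_sub 0 0; rewrite !subrr.
  move=> a _ _ [u Wu <-] [v Wv <-]; exists (a *: u + v); first exact: subspaceP.
  exact: A_linear.
have [l [al ol]] := projection_limit dot_norm y sAW.
have Wl : (W : set H) l.
  apply: closed_rnorm => [|e /al[_ [x Wx <-] lx]]; first exact: subspace_closed.
  by exists (A x) => //; exact: TW.
have yl : y - l = 0.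
  have Wd := subspaceB hW Wy Wl; apply: rnorm_eq0.
  have := A_coercive Wd; rewrite inner_ReC// ol; last by exists (y - l).
  rewrite scalar_Re0 pmulr_rle0// => h; apply/eqP.
  by rewrite -sqrf_eq0 eq_le h sqr_ge0.
have {ol Wl yl al} approx (n : nat) :
    exists x, (W : set H) x /\ rnorm (y - A x) <= n.+1%:R^-1.
  have [|_ [x Wx <-] lx] := al n.+1%:R^-1; first by rewrite invr_gt0.
  by exists x; split=> //; move/eqP: yl; rewrite subr_eq0 => /eqP->.
have [x hx] := choice approx.
have near_small (e : R) : 0 < e -> exists N, forall n, (N <= n)%N ->
    rnorm (y - A (x n)) <= e.
  move=> e0; have [N _ hN] := near_infty_natSinv_lt (PosNum e0).
  by exists N => n Nn; rewrite (le_trans (hx n).2)// ltW//; exact: hN.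
have : cvg (x @ \oo).
  apply: cvg_rnorm_cauchy => e e0.
  have [|N hN] := near_small (alpha * e / 2).
    by rewrite divr_gt0// mulr_gt0.
  exists N; exists N => // n /= Nn.
  rewrite -(ler_pM2l alpha0) (le_trans (A_lower _))//.
    by apply: subspaceB => //; [exact: (hx N).1|exact: (hx n).1].
  rewrite A_sub (le_trans (rnorm_triangle y _ _))// rnormB.
  by have := hN N (leqnn N); have := hN n Nn; lra.
move/cvg_ex => [z /cvg_rnormP xz].
have Wz : (W : set H) z.
  apply: closed_rnorm => [|e /xz[N _ /(_ N (leqnn N)) zx]].
    exact: subspace_closed.
  by exists (x N) => //; exact: (hx N).1.
exists z => //; apply/eqP; rewrite -subr_eq0; apply/eqP/rnorm_eq0.
apply/eqP; rewrite eq_le rnorm_ge0 andbT.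
suff h (e : R) : 0 < e -> rnorm (A z - y) <= 0 + e by exact/ler_addgt0Pr.
move=> e0; rewrite add0r.
have c0 : 0 < beta ^+ 2 + 1 by rewrite ltr_wpDl ?sqr_ge0.
have [|N _ hN] := xz (e / 2 / (beta ^+ 2 + 1)); first by rewrite !divr_gt0.
have [|N' hN'] := near_small (e / 2); first by rewrite divr_gt0.
have h1 := hN (maxn N N') (leq_maxl _ _); have h2 := hN' _ (leq_maxr N N').
move: (maxn N N') h1 h2 => n h1 h2.
rewrite (le_trans (rnorm_triangle (A (x n)) _ _))// -A_sub (rnormB (A (x n))).
rewrite ler_pdivlMr// in h1.
have h3 := A_bounded (z - x n); have h4 := rnorm_ge0 (z - x n).
by nra.
Qed.

(** With q the inverse of the restriction of T S to W, precomposed with the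
    orthogonal projection on W, the pseudo-inverse is S q. *)
Lemma pseudo_inverse_exists : exists S', is_pseudo_inverse dU dot T S'.
Proof.
have solve y : exists x, (W : set H) x /\ A x = orth_proj dot W y.
  have [Wp _] := orth_projP dot_norm W y.
  by have [x] := frame_operator_surj Wp; exists x.
have [q hq] := choice solve.
have qW y : (W : set H) (q y) := (hq y).1.
have Aq y : A (q y) = orth_proj dot W y := (hq y).2.
have q_linear : linear q.
  move=> a x y; apply: A_inj => //; first exact: subspaceP.
  by rewrite A_linear !Aq orth_proj_linear.
have qA x : (W : set H) x -> q (A x) = x.
  by move=> Wx; apply: A_inj => //; rewrite Aq orth_proj_id//; exact: TW.
have qproj y : q (orth_proj dot W y) = q y.
  have [Wp _] := orth_projP dot_norm W y.
  by apply: A_inj => //; rewrite !Aq orth_proj_id.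
have q_sym x y : dot (q x) y = dot x (q y).
  have A_sym u v : dot (A u) v = dot u (A v).
    by rewrite adjTS [RHS]innerC// adjTS -innerC.
  rewrite -(dot_orth_proj dot_norm y (qW x)) -Aq -A_sym Aq.
  by rewrite orth_proj_sym// orth_proj_id.
have TSq y : T (S (q y)) = orth_proj dot W y by exact: Aq.
exists (fun y => S (q y)); split.
- by move=> a x y /=; rewrite q_linear linS.
- exists (beta / alpha) => y.
  have qy : alpha * rnorm (q y) <= rnorm y.
    have [->|qy0] := eqVneq (rnorm (q y)) 0; first by rewrite mulr0 rnorm_ge0.
    have qy_gt0 : 0 < rnorm (q y) by rewrite lt0r qy0 rnorm_ge0.
    rewrite -(ler_pM2r qy_gt0) -mulrA -expr2 (le_trans (A_coercive _))// Aq.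
    rewrite orth_proj_sym// orth_proj_id// -!hnormr; exact: inner_CS.
  rewrite (le_trans (S_upper _))// hnormr -mulrA ler_wpM2l//.
  by rewrite mulrC ler_pdivlMr// mulrC.
- by split=> x; rewrite TSq ?qproj// orth_proj_id.
- by move=> x y; rewrite !TSq orth_proj_sym.
- move=> x y; rewrite -[RHS]adjTS -q_sym [LHS]innerC//.
  by rewrite -adjTS -innerC.
Qed.

End Coercive.

(** * Synthesis and analysis operators of a fusion frame *)

Section FusionFrame.
Variables (R : realType) (k : scalar_kind).
Local Notation K := (scalars R k).
Variables (H : completeNormedModType K) (dot : {dot H for @scalar_conj R k}).
Hypothesis dot_norm : forall x : H, dot x x = `|x| ^+ 2.
Variables (I : countType) (W : closed_subspace H) (Ws : I -> closed_subspace H).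
Variables (w : I -> R) (alpha beta : R).
Hypothesis WsW : forall i, (Ws i : set H) `<=` W.
Hypotheses (alpha0 : 0 < alpha) (beta0 : 0 < beta).
Hypothesis frame_bounds : forall f, (W : set H) f ->
  ((alpha * hnorm dot f ^+ 2)%:E <=
     \esum_(i in setT)
       (w i ^+ 2 * hnorm dot (orth_proj dot (Ws i) f) ^+ 2)%:E <=
   (beta * hnorm dot f ^+ 2)%:E)%E.
Local Notation FS := (fusion_space dot Ws).
Local Notation fdot := (fusion_dot dot Ws).
Local Notation T := (synthesis dot Ws w).

Let hdot := dot_inner_product dot.
Let hnormr := hnorm_rnorm dot_norm.
Let hfdot := fusion_dot_inner_product dot_norm Ws.

Lemma rnorm_orth_proj (V : closed_subspace H) x :
  rnorm (orth_proj dot V x) <= rnorm x.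
Proof.
set p := orth_proj dot V x.
have [->|p0] := eqVneq (rnorm p) 0; first exact: rnorm_ge0.
have p_gt0 : 0 < rnorm p by rewrite lt0r p0 rnorm_ge0.
rewrite -(ler_pM2l p_gt0) -expr2 -{1}hnormr hnormE//.
have Vp : (V : set H) p := (orth_projP dot_norm V x).1.
by rewrite {2}/p (dot_orth_proj dot_norm x Vp) -!hnormr; exact: inner_CS.
Qed.

(** The frame bounds concern vectors of W only; this reduces the Bessel bound
    for an arbitrary vector to its projection on W. *)
Lemma orth_proj_comp i x :
  orth_proj dot (Ws i) (orth_proj dot W x) = orth_proj dot (Ws i) x.
Proof.
have [Wp Op] := orth_projP dot_norm W x.
have [Wi Oi] := orth_projP dot_norm (Ws i) (orth_proj dot W x).
apply/esym/oblique_proj_unique => //.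
- exact: closed_subspaceP.
- exact: orthocomp_subspace.
- exact: direct_sum_orthocomp.
rewrite -[x in x - _](subrK (orth_proj dot W x)) -addrA.
apply: (subspaceD (orthocomp_subspace dot (Ws i))) => // v Wv.
by apply: Op; exact: WsW Wv.
Qed.

Lemma bessel f (F : {fset I}) :
  \sum_(i <- F) w i ^+ 2 * rnorm (orth_proj dot (Ws i) f) ^+ 2 <=
  beta * rnorm f ^+ 2.
Proof.
have [Wp _] := orth_projP dot_norm W f.
have /andP[_ /esum_leP h] := frame_bounds Wp.
have {h} := h (fun i => mulr_ge0 (sqr_ge0 _) (sqr_ge0 _)) F.
under eq_bigr do rewrite orth_proj_comp hnormr.
move/le_trans; apply; rewrite hnormr ler_pM2l// ler_pXn2r ?nnegrE ?rnorm_ge0//.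
exact: rnorm_orth_proj.
Qed.

Lemma analysis_in_fusion_space f :
  (fun i => real_scalar k (w i) *: orth_proj dot (Ws i) f)
    \in fusion_space_pred dot Ws.
Proof.
apply/(fusion_spaceP dot_norm); split=> [i|].
  apply: subspaceZ; first exact: closed_subspaceP.
  exact: (orth_projP dot_norm (Ws i) f).1.
exists (beta * rnorm f ^+ 2) => F; apply: le_trans (bessel f F).
apply: ler_sum => i _.
by rewrite rnormZ rnorm_real exprMn real_normK ?num_real.
Qed.

Definition analysis f : FS := FusionSpace (analysis_in_fusion_space f).

Lemma analysis_linear : linear analysis.
Proof.
move=> a x y; apply/val_inj/funext => i /=.
rewrite orth_proj_linear// scalerDr !scalerA [_ * a]mulrC.
by rewrite -scalerA.
Qed.

Lemma analysis_upper f : hnorm fdot (analysis f) <= Num.sqrt beta * rnorm f.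
Proof.
rewrite -(@ler_pXn2r _ 2)// ?nnegrE ?mulr_ge0 ?sqrtr_ge0 ?rnorm_ge0//.
rewrite exprMn [Num.sqrt beta ^+ 2]sqr_sqrtr ?(ltW beta0)//.
apply: (fusion_norm_le dot_norm) => F.
apply: le_trans (bessel f F); apply: ler_sum => i _ /=.
by rewrite rnormZ rnorm_real exprMn real_normK ?num_real.
Qed.

Lemma analysis_lower f : (W : set H) f ->
  alpha * rnorm f ^+ 2 <= hnorm fdot (analysis f) ^+ 2.
Proof.
move=> Wf; have /andP[h _] := frame_bounds Wf.
rewrite -lee_fin -hnormr (le_trans h)//; apply/esum_leP => [i|F].
  by rewrite mulr_ge0 ?sqr_ge0.
apply: le_trans (fusion_norm_ge dot_norm (analysis f) F).
apply: ler_sum => i _ /=.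
by rewrite rnormZ rnorm_real exprMn real_normK ?num_real// hnormr.
Qed.

Lemma fusion_mem (g : FS) i : (Ws i : set H) (g i).
Proof. exact: ((fusion_spaceP dot_norm _ _).1 (valP g)).1. Qed.

(** The Bessel bound for the coefficients of y gives by duality a bound on the
    finite sums y, using the inequality between the arithmetic and the geometric
    mean of beta |g i|^2 and the squared norm of the i-th coefficient over beta.
    *)
Lemma rnorm_finite_synthesis (g : FS) (F : {fset I}) :
  rnorm (\sum_(i <- F) real_scalar k (w i) *: g i) ^+ 2 <=
  beta * \sum_(i <- F) rnorm (g i) ^+ 2.
Proof.
set y := \sum_(i <- F) _.
suff h : rnorm y ^+ 2 <=
    (beta * (\sum_(i <- F) rnorm (g i) ^+ 2) + beta^-1 *
     (\sum_(i <- F) w i ^+ 2 * rnorm (orth_proj dot (Ws i) y) ^+ 2)) / 2.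
  have : beta^-1 *
      (\sum_(i <- F) w i ^+ 2 * rnorm (orth_proj dot (Ws i) y) ^+ 2)
      <= rnorm y ^+ 2.
    by rewrite mulrC ler_pdivrMr// mulrC bessel.
  by lra.
rewrite -{1}hnormr hnormE// {1}/y inner_suml// scalar_Re_sum !mulr_sumr.
rewrite -big_split /= mulr_suml; apply: ler_sum => i _.
rewrite innerZl// scalar_Re_realM -(dot_orth_proj dot_norm y (fusion_mem g i)).
set p := orth_proj _ _ _.
have h1 := ler_norm (w i * scalar_Re (dot (g i) p)).
rewrite (le_trans h1)// normrM.
have h2 := inner_CS_abs hdot (g i) p; rewrite !hnormr in h2.
rewrite (le_trans (ler_wpM2l (normr_ge0 _) h2))//.
rewrite -[w i ^+ 2](real_normK (num_real _)).
rewrite -subr_ge0.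
have -> : (beta * rnorm (g i) ^+ 2 + beta^-1 * (`|w i| ^+ 2 * rnorm p ^+ 2)) / 2
   - `|w i| * (rnorm (g i) * rnorm p) =
   (beta * rnorm (g i) - `|w i| * rnorm p) ^+ 2 / (2 * beta).
  by field; rewrite gt_eqF.
by rewrite divr_ge0 ?sqr_ge0// mulr_ge0// ltW.
Qed.

Lemma synthesis_cvg (g : FS) :
  summability.partial_sum (fun i => real_scalar k (w i) *: g i)
    @ summability.totally --> T g.
Proof.
suff : cvg (summability.partial_sum (fun i => real_scalar k (w i) *: g i) @
            summability.totally) by [].
have [_ gC] := (fusion_spaceP dot_norm _ _).1 (valP g).
apply: cvg_partial_sum gC _ => [i|e e0]; first exact: sqr_ge0.
exists (e ^+ 2 / beta); first by rewrite divr_gt0// exprn_gt0.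
move=> F hF; rewrite -(@ler_pXn2r _ 2)// ?nnegrE ?rnorm_ge0 ?(ltW e0)//.
rewrite (le_trans (rnorm_finite_synthesis g F))//.
by rewrite mulrC -ler_pdivlMr.
Qed.

Lemma synthesis_adjoint : is_adjoint fdot dot T analysis.
Proof.
move=> g y; apply/esym/(fusion_dot_eq dot_norm).
rewrite (_ : summability.partial_sum _ = fun F => dot (summability.partial_sum
    (fun i => real_scalar k (w i) *: g i) F) y).
  by apply: dot_cvgl => //; exact: synthesis_cvg.
apply/funext => F; rewrite !partial_sumE inner_suml//.
apply: eq_bigr => i _ /=; rewrite innerZl// innerZr// scalar_conj_real.
by rewrite (dot_orth_proj dot_norm y (fusion_mem g i)).
Qed.

Lemma synthesis_in (g : FS) : (W : set H) (T g).
Proof.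
apply: closed_rnorm => [|e e0]; first exact: subspace_closed.
have /cvg_rnormP/(_ e e0)/filter_ex[F hF] := @synthesis_cvg g.
exists (summability.partial_sum (fun i => real_scalar k (w i) *: g i) F) => //.
have hW := closed_subspaceP W.
rewrite partial_sumE; elim/big_ind: _ => [|x y|i _]; first exact: subspace0.
  exact: subspaceD.
by apply: subspaceZ => //; apply: (@WsW i); exact: fusion_mem.
Qed.

End FusionFrame.

(** * Consistent reconstruction *)

Lemma xget_in (T : choiceType) (x0 : T) (P : set T) :
  (exists x, P x) -> P (xget x0 P).
Proof. by move=> [x Px]; case: xgetP => [y -> //|/(_ x)]. Qed.


Theorem theorem3p15 (R : realType) (k : scalar_kind)
    (H : completeNormedModType (scalars R k))
    (dot : {dot H for @scalar_conj R k})
    (dot_norm : forall x : H, dot x x = `|x| ^+ 2)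
    (sepH : separable_space H)
    (I : countType) (V W : closed_subspace H) (Ws : I -> closed_subspace H)
    (w : I -> R)
    (HVW : direct_sum V (orthocomp dot W))
    (frameW : fusion_frame dot Ws W w)
    (f fr : H) (Vfr : (V : set H) fr) (eps : R) (eps_ge0 : 0 <= eps) :
  let proj := oblique_proj V (orthocomp dot W) in
  let T := synthesis dot Ws w in
  let Tpinv := pseudo_inverse (fusion_dot dot Ws) dot T in
  (consistent_reconstruction dot Ws V w eps f fr ->
     hnorm dot (fr - proj f) <=
       eps * opnorm dot dot proj * opnorm dot (fusion_dot dot Ws) Tpinv
         * hnorm dot f) /\
  (hnorm dot (fr - proj f) <=
       eps / opnorm (fusion_dot dot Ws) dot T * hnorm dot f ->
     consistent_reconstruction dot Ws V w eps f fr).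
Proof.
move=> proj T Tpinv.
have hdot := dot_inner_product dot.
have hfdot := fusion_dot_inner_product dot_norm Ws.
have hnormr := hnorm_rnorm dot_norm.
have hV := closed_subspaceP V; have hW := closed_subspaceP W.
have hWo := orthocomp_subspace dot W.
have [WsW _ _ [alpha [beta [alpha0 alpha_beta bounds]]]] := frameW.
have beta0 := lt_le_trans alpha0 alpha_beta.
pose S := analysis dot_norm WsW beta0 bounds.
have adjS : is_adjoint (fusion_dot dot Ws) dot T S by exact: synthesis_adjoint.
have TW : forall g, (W : set H) (T g).
  by move=> g; exact: (synthesis_in dot_norm WsW beta0 bounds).
have S_linear : linear S by exact: analysis_linear.
have S_upper : forall x,
    hnorm (fusion_dot dot Ws) (S x) <= Num.sqrt beta * rnorm x.
  by move=> x; exact: analysis_upper.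
have S_lower : forall x, (W : set H) x ->
    alpha * rnorm x ^+ 2 <= hnorm (fusion_dot dot Ws) (S x) ^+ 2.
  by move=> x Wx; exact: analysis_lower.
have T_linear := adjoint_linear dot_norm hfdot adjS.
have T_bounded := adjoint_bounded dot_norm hfdot adjS (sqrtr_ge0 beta) S_upper.
(* The adjoint and the pseudo-inverse of the statement are chosen among the
   maps with the defining property, of which one exists. *)
have adjTa := xget_in (fun=> 0)
  (ex_intro (is_adjoint (fusion_dot dot Ws) dot T) _ adjS).
have [P_linear [M PM] [TPT _] P_sym _] :
    is_pseudo_inverse (fusion_dot dot Ws) dot T Tpinv.
  apply: xget_in.
  exact: (pseudo_inverse_exists dot_norm hfdot adjS S_linear TW alpha0
           (sqrtr_ge0 beta) S_lower S_upper).
set Ta := xget _ _ in adjTa.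
have -> : consistent_reconstruction dot Ws V w eps f fr =
    ((V : set H) fr /\
     hnorm (fusion_dot dot Ws) (Ta fr - Ta f) <= eps * hnorm dot f) by [].
have homogeneous (X Y : lmodType (scalars R k)) (L : X -> Y) : linear L ->
    forall t x, L (real_scalar k t *: x) = real_scalar k t *: L x.
  move=> hL t x; have L0 : L 0 = 0.
    by have := hL (-1) 0 0; rewrite !scaleN1r !addNr.
  by have := hL (real_scalar k t) x 0; rewrite L0 !addr0.
have [VPf WPf] := oblique_projP f HVW.
set u := fr - proj f; set g := Ta fr - Ta f.
have Vu : (V : set H) u by exact: subspaceB.
have Tu h : dot (T h) u = fusion_dot dot Ws h g.
  rewrite /g (innerBr hfdot) -!adjTa -(innerBr hdot); apply/eqP.
  rewrite -subr_eq0 -(innerBr hdot).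
  have -> : u - (fr - f) = f - proj f by rewrite /u opprB addrC addrA subrK.
  by rewrite (orthocomp_sym WPf).
have T_le h : hnorm dot (T h) <=
    opnorm (fusion_dot dot Ws) dot T * hnorm (fusion_dot dot Ws) h.
  apply: (opnorm_bound hfdot hdot (homogeneous _ _ _ T_linear)
            (M := Num.sqrt beta)) => x.
  by rewrite hnormr; exact: T_bounded.
split=> [[_ cons]|close].
  (* p is the orthogonal projection of u on W *)
  pose p := T (Tpinv u).
  have up : orthocomp dot W (u - p).
    move=> x Wx; rewrite innerBl// P_sym.
    have [y Wy <-] := frame_operator_surj dot_norm hfdot adjS S_linear TW alpha0
      (sqrtr_ge0 beta) S_lower S_upper Wx.
    by rewrite TPT subrr.
  have pu : proj p = u.
    apply: oblique_proj_unique => //.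
    by have := subspaceZ (-1) hWo up; rewrite scaleN1r opprB.
  have p_le : hnorm dot p <=
      opnorm dot (fusion_dot dot Ws) Tpinv * hnorm (fusion_dot dot Ws) g.
    have [->|p0] := eqVneq (hnorm dot p) 0.
      rewrite mulr_ge0 ?hnorm_ge0//.
      exact: (opnorm_ge0 hdot PM).
    have p_gt0 : 0 < hnorm dot p by rewrite lt0r p0 hnorm_ge0.
    have Wp : (W : set H) p := TW _.
    rewrite -(ler_pM2l p_gt0) -expr2 hnormE//.
    have -> : dot p p = fusion_dot dot Ws (Tpinv p) g.
      rewrite -Tu /p TPT -/p; apply/eqP.
      by rewrite eq_sym -subr_eq0 -innerBr// (orthocomp_sym up).
    rewrite (le_trans (inner_CS hfdot _ _))// mulrCA mulrA.
    rewrite ler_wpM2r ?hnorm_ge0//.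
    exact: (opnorm_bound hdot hfdot (homogeneous _ _ _ P_linear) PM).
  have [N PN] := oblique_proj_bounded dot_norm HVW.
  have proj_linear : linear proj by move=> a x y; exact: oblique_proj_linear.
  have projN x : hnorm dot (proj x) <= N * hnorm dot x by rewrite !hnormr.
  rewrite -[u in hnorm dot u]pu.
  have proj_le := opnorm_bound hdot hdot (homogeneous _ _ _ proj_linear) projN.
  rewrite (le_trans (proj_le p))//.
  rewrite [leRHS](_ : _ = opnorm dot dot proj *
    (opnorm dot (fusion_dot dot Ws) Tpinv * (eps * hnorm dot f))); last by ring.
  rewrite ler_wpM2l ?(opnorm_ge0 hdot projN)// (le_trans p_le)//.
  by rewrite ler_wpM2l// (opnorm_ge0 hdot PM).
split=> //.
(* If T = 0 the quotient by its norm is 0, but then g = 0 as well. *)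
have [->|g0] := eqVneq (hnorm (fusion_dot dot Ws) g) 0.
  by rewrite mulr_ge0 ?hnorm_ge0.
have g_gt0 : 0 < hnorm (fusion_dot dot Ws) g by rewrite lt0r g0 hnorm_ge0.
have g_le : hnorm (fusion_dot dot Ws) g <=
    opnorm (fusion_dot dot Ws) dot T * hnorm dot u.
  rewrite -(ler_pM2l g_gt0) -expr2 hnormE// -Tu.
  rewrite (le_trans (inner_CS hdot _ _))//.
  by rewrite mulrCA mulrA ler_wpM2r ?hnorm_ge0.
have T_gt0 : 0 < opnorm (fusion_dot dot Ws) dot T.
  rewrite lt0r (opnorm_ge0 hfdot (M := Num.sqrt beta)) => [|x]; last first.
    by rewrite hnormr; exact: T_bounded.
  rewrite andbT; apply: contraTneq g_gt0 => T0.
  by rewrite -leNgt (le_trans g_le)// T0 mul0r.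
rewrite (le_trans g_le)// (le_trans (ler_wpM2l (ltW T_gt0) close))//.
by rewrite mulrA mulrCA divff ?gt_eqF// mulr1.
Qed.
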